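(* Let $p$ be a prime and let $B$ be a connected finite CW-complex with $H_2(\pi_1(B);\mathbb{F}_p)=0$. Then for any integer $r\ge 0$ and any (connected) regular $(\mathbb{Z}_p)^r$-covering $X$ over $B$, we have $b_1(X;\mathbb{F}_p)\geq 2^r-1$.
   Context: $\mathbb{Z}_p=\mathbb{F}_p=\mathbb{Z}/p\mathbb{Z}$. A regular $G$-covering $X$ over $B$ is a connected regular covering space of $B$ with deck transformation group $G$, so that $\pi_1(B)/\pi_1(X)\cong G$. For a space $X$ and a field $\mathbb{F}$, $b_i(X;\mathbb{F})=\dim_{\mathbb{F}}H_i(X;\mathbb{F})$. For a group $\Gamma$, $H_i(\Gamma;\mathbb{F}_p)=H_i(K(\Gamma,1);\mathbb{F}_p)$ is group homology with trivial coefficients. *)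

(* Defs.v *)
From HB Require Import structures.
From mathcomp Require Import all_boot all_order all_algebra generic_quotient.
From mathcomp Require Import all_classical all_reals.
From mathcomp Require Import ereal topology normedtype.
From mathcomp.multinomials Require Import freeg.
From mathcomp Require Import lra zify.

Set Implicit Arguments.
Unset Strict Implicit.
Unset Printing Implicit Defensive.

Import Order.TTheory GRing.Theory Num.Theory numFieldNormedType.Exports.

Local Open Scope classical_set_scope.
Local Open Scope ring_scope.
Local Open Scope quotient_scope.

Record semisimplicial := Semisimplicial {
  simplices :> nat -> choiceType;
  face : forall n, 'I_n.+2 -> simplices n.+1 -> simplices n;
  face_face : forall n (i : 'I_n.+2) (j : 'I_n.+3) x, (i < j)%N ->
    face i (face j x) = face (inord j.-1) (face (inord i) x) }.

Section Homology.
Variables (F : fieldType) (S : semisimplicial).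

Definition chain n := {freeg (S n) / F}.

Definition boundary n : chain n.+1 -> chain n :=
  fglift (fun x => \sum_(i < n.+2) (-1) ^+ i *: << face i x >>).

Definition cycles n : set (chain n) :=
  if n is m.+1 return set (chain n) then [set c | boundary c = 0] else setT.

Definition boundaries n : set (chain n) := range (@boundary n).

Arguments cycles n : clear implicits.
Arguments boundaries n : clear implicits.

Definition homology_eq0 n : Prop := cycles n `<=` boundaries n.

(* The classes of the v i are linearly independent in H_n. *)
Definition homology_free n m (v : 'I_m -> chain n) : Prop :=
  (forall i, cycles n (v i)) /\
  (forall a : 'I_m -> F,
     boundaries n (\sum_i a i *: v i) -> forall i, a i = 0).

(* dim H_n, equal to +oo when H_n is infinite-dimensional. *)
Definition homology_dim (R : realType) n : \bar R :=
  ereal_sup [set m%:R%:E | m in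
    [set m | exists v : 'I_m -> chain n, homology_free v]].

End Homology.

Lemma inordE n k : val (inord k : 'I_n.+1) = if (k < n.+1)%N then k else 0%N.
Proof.
by rewrite /inord /insubd; case: insubP => [? -> //|/negbTE ->].
Qed.

Ltac case_if tac := repeat match goal with
  |- context [if ?b then _ else _] =>
    lazymatch b with
    | context [if _ then _ else _] => fail
    | _ => case: (boolP b) => ?; tac
    end
  end.

Section Singular.
Variable R : realType.

Definition std_simplex n : set 'rV[R]_n.+1 :=
  [set x | (forall i, 0 <= x 0 i) /\ \sum_i x 0 i = 1].

Definition insert0 n (i : 'I_n.+2) (x : 'rV[R]_n.+1) : 'rV[R]_n.+2 :=
  \row_j (if unlift i j is Some k then x 0 k else 0).

Lemma insert0_simplex n i (x : 'rV[R]_n.+1) :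
  std_simplex x -> std_simplex (insert0 i x).
Proof.
case=> x0 x1; split=> [j|]; first by rewrite mxE; case: unliftP.
rewrite (bigD1_ord i) //= mxE unlift_none add0r -x1.
by apply: eq_bigr => k _; rewrite mxE liftK.
Qed.

Definition coface n (i : 'I_n.+2) (x : @std_simplex n) : @std_simplex n.+1 :=
  SigSub (mem_set (insert0_simplex i (set_valP x))).

Lemma insert0_continuous n (i : 'I_n.+2) : continuous (@insert0 n i).
Proof.
move=> x A [P Px PA].
have := @filter_forall _ _ (fun j y => P 0 j (insert0 i y 0 j)) _ (nbhs_filter x).
move=> near_all; apply: (@filterS _ _ (nbhs_filter x)); last first.
  apply: near_all => j; move: (Px 0 j); rewrite !mxE.
  case: unliftP => [k|] jE Pxj.
    have := @coord_continuous R 1 n.+1 0 k x _ Pxj.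
    by apply: (@filterS _ _ (nbhs_filter x)) => y /=; rewrite mxE jE liftK.
  apply: (@filterE _ _ (nbhs_filter x)) => y /=; rewrite mxE jE unlift_none.
  by rewrite -jE; exact: (nbhs_singleton Pxj).
by move=> y Py; apply: PA => k j; rewrite !ord1; exact: Py.
Qed.

Lemma coface_continuous n (i : 'I_n.+2) : continuous (@coface n i).
Proof.
apply: continuous_comp_initial => x.
apply: (@continuous_comp _ _ _ set_val (@insert0 n i)).
  exact: initial_continuous.
exact: insert0_continuous.
Qed.

HB.instance Definition _ n (i : 'I_n.+2) :=
  isContinuous.Build _ _ (@coface n i) (@coface_continuous n i).

Lemma insert0E n (i : 'I_n.+2) (x : 'rV[R]_n.+1) (j : 'I_n.+2) :
  insert0 i x 0 j = if (j < i)%N then x 0 (inord j)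
                    else if j == i :> nat then 0 else x 0 (inord j.-1).
Proof.
rewrite mxE; case: unliftP => [k|] ->; last by rewrite ltnn eqxx.
rewrite /= /bump; case: leqP => ik; case: ltnP => //= ?; try lia.
- by rewrite (_ : (_ == _) = false); [rewrite inord_val|lia].
- by rewrite inord_val.
Qed.

Lemma insert0_insert0 n (i : 'I_n.+2) (j : 'I_n.+3) x : (i < j)%N ->
  insert0 j (insert0 i x) = insert0 (inord i) (insert0 (inord j.-1) x).
Proof.
move=> ij; apply/rowP => k.
have [ltj ltk] := (ltn_ord j, ltn_ord k).
rewrite !(insert0E, inordE); case_if ltac:(try (exfalso; lia)) => //;
  by congr (x 0 (inord _)); lia.
Qed.

Variable X : topologicalType.

Definition singular_face n (i : 'I_n.+2)
    (s : continuousType (@std_simplex n.+1) X) :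
    continuousType (@std_simplex n) X :=
  s \o @coface n i.

Lemma singular_face_face n (i : 'I_n.+2) (j : 'I_n.+3) s : (i < j)%N ->
  singular_face i (singular_face j s) =
  singular_face (inord j.-1) (singular_face (inord i) s).
Proof.
move=> ij; apply/continuousEP => x /=; congr (s _).
by apply: val_inj => /=; exact: insert0_insert0.
Qed.

Definition singular : semisimplicial :=
  @Semisimplicial (fun n => continuousType (@std_simplex n) X)
    singular_face singular_face_face.

End Singular.

Definition betti (R : realType) (F : fieldType) (X : topologicalType) (n : nat)
  : \bar R := homology_dim F (singular R X) R n.

Section Nerve.
Variable G : groupType.
Local Open Scope group_scope.

(* d_0 drops g_1, d_(n+1) drops g_(n+1), and d_i replaces the consecutive
   entries g_i, g_(i+1) by their product. *)
Definition nerve_face n (i : 'I_n.+2) (g : {ffun 'I_n.+1 -> G}) :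
    {ffun 'I_n -> G} :=
  [ffun j : 'I_n =>
    if (j.+1 < i)%N then g (inord j)
    else if j.+1 == i then g (inord j) * g (inord j.+1)
    else g (inord j.+1)].

Lemma nerve_face_face n (i : 'I_n.+2) (j : 'I_n.+3) g : (i < j)%N ->
  nerve_face i (nerve_face j g) =
  nerve_face (inord j.-1) (nerve_face (inord i) g).
Proof.
move=> ij; apply/ffunP => k.
have [ltj ltk] := (ltn_ord j, ltn_ord k).
rewrite !(ffunE, inordE).
case_if ltac:(try (exfalso; lia)); rewrite ?mulgA; do ?congr (_ * _);
  by congr (g (inord _)); lia.
Qed.

(* The standard simplicial model of K(G,1). *)
Definition nerve : semisimplicial :=
  @Semisimplicial (fun n => {ffun 'I_n -> G}) nerve_face nerve_face_face.

End Nerve.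

Section FundamentalGroup.
Variables (R : realType) (T : topologicalType) (b : T).

(* Only the values on [0, 1] are meaningful. *)
Definition is_loop (f : R -> T) : Prop :=
  [/\ {within `[0, 1], continuous f}, f 0 = b & f 1 = b].

Record loop := Loop { loop_fun :> R -> T; loopP : is_loop loop_fun }.

HB.instance Definition _ := gen_eqMixin loop.
HB.instance Definition _ := gen_choiceMixin loop.

Definition homotopic (f g : loop) : Prop := exists H : R * R -> T,
  [/\ {within `[0, 1] `*` `[0, 1], continuous H},
      forall t, `[0, 1]%classic t -> H (0, t) = f t,
      forall t, `[0, 1]%classic t -> H (1, t) = g t,
      forall s, `[0, 1]%classic s -> H (s, 0) = b &
      forall s, `[0, 1]%classic s -> H (s, 1) = b].

Definition clamp (t : R) : R := Num.max 0 (Num.min t 1).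

Lemma clampI t : `[0, 1]%classic (clamp t).
Proof. by rewrite /= in_itv /= /clamp /Order.max /Order.min; case: ifP; case: ifP; lra. Qed.

Lemma clampE t : `[0, 1]%classic t -> clamp t = t.
Proof.
rewrite /= in_itv /= => t01.
by rewrite /clamp /Order.max /Order.min; case: ifP; case: ifP; lra.
Qed.

Lemma clamp_id t : clamp (clamp t) = clamp t.
Proof. by rewrite clampE //; exact: clampI. Qed.

Lemma clamp0 : clamp 0 = 0.
Proof. by rewrite clampE //= in_itv /= lexx ler01. Qed.

Lemma clamp1 : clamp 1 = 1.
Proof. by rewrite clampE //= in_itv /= lexx ler01. Qed.

Lemma fun_continuous_pair (X Y Z : topologicalType) (f : X -> Y) (g : X -> Z) :
  continuous f -> continuous g -> continuous (fun x => (f x, g x)).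
Proof. by move=> cf cg x; apply: cvg_pair; [exact: cf|exact: cg]. Qed.

Lemma continuous_compT (X Y Z : topologicalType) (f : X -> Y) (g : Y -> Z) :
  continuous f -> continuous g -> continuous (fun x => g (f x)).
Proof. by move=> cf cg x; apply: (continuous_comp (cf x) (cg (f x))). Qed.

Lemma fun_continuous_max (X : topologicalType) (f g : X -> R) :
  continuous f -> continuous g -> continuous (fun x => Num.max (f x) (g x)).
Proof. by move=> cf cg x; apply: (continuous_max (cf x) (cg x)). Qed.

Lemma fun_continuous_min (X : topologicalType) (f g : X -> R) :
  continuous f -> continuous g -> continuous (fun x => Num.min (f x) (g x)).
Proof. by move=> cf cg x; apply: (continuous_min (cf x) (cg x)). Qed.

Lemma fun_continuousD (X : topologicalType) (f g : X -> R) :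
  continuous f -> continuous g -> continuous (fun x => f x + g x).
Proof. by move=> cf cg x; apply: continuousD; [exact: cf|exact: cg]. Qed.

Lemma fun_continuousN (X : topologicalType) (f : X -> R) :
  continuous f -> continuous (fun x => - f x).
Proof. by move=> cf x; apply: continuousN; exact: cf. Qed.

Lemma fun_continuousM (X : topologicalType) (f g : X -> R) :
  continuous f -> continuous g -> continuous (fun x => f x * g x).
Proof. by move=> cf cg x; apply: continuousM; [exact: cf|exact: cg]. Qed.

Lemma fun_continuous_cst (X Y : topologicalType) (c : Y) :
  continuous (fun _ : X => c).
Proof. by move=> x; exact: cvg_cst. Qed.

Lemma fun_continuous_fst (X Y : topologicalType) : continuous (fun x : X * Y => x.1).
Proof. by move=> x; exact: cvg_fst. Qed.

Lemma fun_continuous_snd (X Y : topologicalType) : continuous (fun x : X * Y => x.2).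
Proof. by move=> x; exact: cvg_snd. Qed.

Lemma fun_continuous_id (X : topologicalType) : continuous (fun x : X => x).
Proof. by move=> x; exact: cvg_id. Qed.

Ltac ctn := lazymatch goal with
  | |- continuous (fun x => @?f x + @?g x) => apply: (@fun_continuousD _ f g); ctn
  | |- continuous (fun x => - @?f x) => apply: (@fun_continuousN _ f); ctn
  | |- continuous (fun x => @?f x * @?g x) => apply: (@fun_continuousM _ f g); ctn
  | |- continuous (fun x => Num.max (@?f x) (@?g x)) =>
      apply: (@fun_continuous_max _ f g); ctn
  | |- continuous (fun x => Num.min (@?f x) (@?g x)) =>
      apply: (@fun_continuous_min _ f g); ctn
  | |- continuous (fun _ => ?c) => exact: fun_continuous_cst
  | |- continuous (fun x => x) => exact: fun_continuous_id
  | |- continuous (fun x => x.1) => exact: fun_continuous_fst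
  | |- continuous (fun x => x.2) => exact: fun_continuous_snd
  | |- _ => first
      [ assumption | exact: fun_continuous_id | exact: fun_continuous_fst
      | exact: fun_continuous_snd ]
  end.

Lemma clamp_continuous : continuous clamp.
Proof. by rewrite /clamp; ctn. Qed.

Lemma glue_continuous (X : topologicalType) (phi : X -> R) (F G : X -> T) :
  continuous phi -> continuous F -> continuous G ->
  (forall x, phi x = 0 -> F x = G x) ->
  continuous (fun x => if phi x <= 0 then F x else G x).
Proof.
move=> cphi cF cG FG.
have cl1 : closed [set x | phi x <= 0].
  by apply: (@preimage_closed _ _ phi [set x | x <= 0]) => //; exact: closed_le.
have cl2 : closed [set x | 0 <= phi x].
  by apply: (@preimage_closed _ _ phi [set x | 0 <= x]) => //; exact: closed_ge.
apply/continuous_subspace_setT.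
have -> : setT = [set x | phi x <= 0] `|` [set x | 0 <= phi x].
  by apply/seteqP; split=> // x _; case: (leP (phi x) 0) => h; [left|right; exact: ltW].
apply: withinU_continuous => //.
- apply: (@subspace_eq_continuous _ _ _ F); last exact: continuous_subspaceT.
  by move=> x; rewrite inE /from_subspace /= => ->.
- apply: (@subspace_eq_continuous _ _ _ G); last exact: continuous_subspaceT.
  move=> x; rewrite inE /from_subspace /= => x0.
  by case: ifP => // x1; rewrite FG //; apply/eqP; rewrite eq_le x1.
Qed.

Lemma within_comp (X Y Z : topologicalType) (A : set Y) (f : X -> Y)
    (g : Y -> Z) :
  continuous f -> {within A, continuous g} -> (forall x, A (f x)) ->
  continuous (fun x => g (f x)).
Proof.
move=> cf /subspace_continuousP cg fA x W gW.
have := cf x _ (cg _ (fA x) W gW).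
by apply: (@filterS _ _ (nbhs_filter x)) => y /= h; apply: h.
Qed.

Lemma clamped_continuous (f : R -> T) :
  {within `[0, 1], continuous f} -> continuous (fun t => f (clamp t)).
Proof. by move=> cf; apply: within_comp cf clampI; exact: clamp_continuous. Qed.

Lemma clamped2_continuous (H : R * R -> T) :
  {within `[0, 1] `*` `[0, 1], continuous H} ->
  continuous (fun z => H (clamp z.1, clamp z.2)).
Proof.
move=> cH; apply: (within_comp (f := fun z => (clamp z.1, clamp z.2)) _ cH) => [|z].
  apply: fun_continuous_pair; apply: continuous_compT clamp_continuous; ctn.
by split; exact: clampI.
Qed.

Lemma within_of_continuous (X : topologicalType) (A : set X) (f g : X -> T) :
  continuous g -> (forall x, A x -> f x = g x) -> {within A, continuous f}.
Proof.
move=> cg fg; apply: (@subspace_eq_continuous _ _ _ g).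
  by move=> x /set_mem Ax; rewrite /from_subspace fg.
exact: continuous_subspaceT.
Qed.

Lemma unit0 : `[0, 1]%classic (0 : R).
Proof. by rewrite /= in_itv /= lexx ler01. Qed.

Lemma unit1 : `[0, 1]%classic (1 : R).
Proof. by rewrite /= in_itv /= lexx ler01. Qed.

Lemma continuous_comp2 (X : topologicalType) (K : R -> R -> T) (f g : X -> R) :
  continuous (fun z : R * R => K z.1 z.2) -> continuous f -> continuous g ->
  continuous (fun x => K (f x) (g x)).
Proof.
by move=> cK cf cg; exact: (continuous_compT (fun_continuous_pair cf cg) cK).
Qed.

Lemma loop_continuous (f : loop) : continuous (fun t => f (clamp t)).
Proof. by case: (loopP f) => cf _ _; exact: clamped_continuous. Qed.

Lemma loop0 (f : loop) : f 0 = b. Proof. by case: (loopP f). Qed.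

Lemma loop1 (f : loop) : f 1 = b. Proof. by case: (loopP f). Qed.

Lemma homotopicI (f g : loop) (K : R -> R -> T) :
  continuous (fun z : R * R => K z.1 z.2) ->
  (forall t, `[0, 1]%classic t -> K 0 t = f t) ->
  (forall t, `[0, 1]%classic t -> K 1 t = g t) ->
  (forall s, `[0, 1]%classic s -> K s 0 = b) ->
  (forall s, `[0, 1]%classic s -> K s 1 = b) -> homotopic f g.
Proof.
by exists (fun z => K z.1 z.2); split=> //; exact: continuous_subspaceT.
Qed.

Lemma homotopicE (f g : loop) : homotopic f g -> exists K : R -> R -> T,
  [/\ continuous (fun z : R * R => K z.1 z.2),
      forall t, `[0, 1]%classic t -> K 0 t = f t,
      forall t, `[0, 1]%classic t -> K 1 t = g t,
      forall s t, t <= 0 -> K s t = b &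
      forall s t, 1 <= t -> K s t = b] /\
  (forall s t, K (clamp s) (clamp t) = K s t).
Proof.
case=> H [cH H0 H1 Hl Hr]; exists (fun s t => H (clamp s, clamp t)).
split; [split|].
- exact: clamped2_continuous.
- by move=> t It; rewrite clamp0 (clampE It) H0.
- by move=> t It; rewrite clamp1 (clampE It) H1.
- move=> s t t0; rewrite (_ : clamp t = 0) ?Hl //; first exact: clampI.
  by rewrite /clamp /Order.max /Order.min; case: ifP; case: ifP; lra.
- move=> s t t0; rewrite (_ : clamp t = 1) ?Hr //; first exact: clampI.
  by rewrite /clamp /Order.max /Order.min; case: ifP; case: ifP; lra.
- by move=> s t; rewrite !clamp_id.
Qed.

Lemma homotopic_refl f : homotopic f f.
Proof.
apply: (@homotopicI _ _ (fun _ t => f (clamp t))).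
- apply: continuous_compT (@loop_continuous f); ctn.
- by move=> t It; rewrite clampE.
- by move=> t It; rewrite clampE.
- by move=> s _; rewrite clamp0 loop0.
- by move=> s _; rewrite clamp1 loop1.
Qed.

Lemma homotopic_sym f g : homotopic f g -> homotopic g f.
Proof.
case/homotopicE=> K [[cK K0 K1 Kl Kr] _].
apply: (@homotopicI _ _ (fun s t => K (1 - s) t)).
- by apply: (@continuous_comp2 _ _ (fun z : R * R => 1 - z.1) (fun z => z.2)) cK _ _; ctn.
- by move=> t It; rewrite subr0 K1.
- by move=> t It; rewrite subrr K0.
- by move=> s _; rewrite Kl.
- by move=> s _; rewrite Kr.
Qed.

Lemma homotopic_trans f g h : homotopic f g -> homotopic g h -> homotopic f h.
Proof.
case/homotopicE=> K [[cK K0 K1 Kl Kr] Kc].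
case/homotopicE=> L [[cL L0 L1 Ll Lr] Lc].
apply: (@homotopicI _ _
  (fun s t => if s * 2 - 1 <= 0 then K (s * 2) t else L (s * 2 - 1) t)).
- apply: (@glue_continuous _ (fun z : R * R => z.1 * 2 - 1) (fun z => K (z.1 * 2) z.2)
    (fun z => L (z.1 * 2 - 1) z.2)).
  + by ctn.
  + by apply: (@continuous_comp2 _ _ (fun z : R * R => z.1 * 2) (fun z => z.2)) cK _ _; ctn.
  + by apply: (@continuous_comp2 _ _ (fun z : R * R => z.1 * 2 - 1) (fun z => z.2)) cL _ _; ctn.
  + move=> z z0; rewrite z0 (_ : z.1 * 2 = 1); last by lra.
    rewrite -Kc -Lc clamp0 clamp1 K1 ?L0 //; exact: clampI.
- by move=> t It; rewrite mul0r sub0r lerN10 K0.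
- move=> t It; rewrite mul1r ifF; last by apply/negbTE; lra.
  by rewrite (_ : 2 - 1 = 1) ?L1 //; lra.
- by move=> s _; case: ifP => _; rewrite ?Kl ?Ll.
- by move=> s _; case: ifP => _; rewrite ?Kr ?Lr.
Qed.

Definition homotopicb : rel loop := fun f g => `[< homotopic f g >].

Lemma homotopicb_equiv : equiv_class_of homotopicb.
Proof.
split=> [f|f g|f g h]; first exact/asboolP/homotopic_refl.
- by apply/asboolP/asboolP; exact: homotopic_sym.
- move=> /asboolP gf /asboolP fh; apply/asboolP; exact: homotopic_trans gf fh.
Qed.

Canonical homotopic_equiv := EquivRelPack homotopicb_equiv.
Canonical homotopic_encModRel := defaultEncModRel homotopicb.

Definition fundamental_group : Type := {eq_quot homotopicb}.

HB.instance Definition _ := Choice.on fundamental_group.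
HB.instance Definition _ := Quotient.on fundamental_group.
HB.instance Definition _ : EqQuotient loop homotopicb fundamental_group :=
  EqQuotient.on fundamental_group.

Definition loop_class (f : loop) : fundamental_group := \pi_fundamental_group f.

Lemma cst_is_loop : is_loop (fun=> b).
Proof. by split=> //; apply: continuous_subspaceT; ctn. Qed.

Definition cst_loop := Loop cst_is_loop.

Definition concat (f g : R -> T) (t : R) : T :=
  if t <= 2^-1 then f (2 * t) else g (2 * t - 1).

Lemma concat_clamp (f g : R -> T) t : `[0, 1]%classic t ->
  concat f g t = if 2 * t - 1 <= 0 then f (clamp (2 * t)) else g (clamp (2 * t - 1)).
Proof.
rewrite /= in_itv /= => /andP[t0 t1]; rewrite /concat.
rewrite (_ : (2 * t - 1 <= 0) = (t <= 2^-1)); last by apply/idP/idP; lra.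
by case: ifP => t2; rewrite clampE //= in_itv /=; apply/andP; split; lra.
Qed.

Lemma concat_is_loop (f g : loop) : is_loop (concat f g).
Proof.
split.
- apply: within_of_continuous (@concat_clamp f g).
  apply: (@glue_continuous _ (fun t : R => 2 * t - 1)
    (fun t => f (clamp (2 * t))) (fun t => g (clamp (2 * t - 1)))).
  + by ctn.
  + apply: (@continuous_compT _ _ _ (fun t : R => 2 * t) _ _ (@loop_continuous f)); ctn.
  + apply: (@continuous_compT _ _ _ (fun t : R => 2 * t - 1) _ _ (@loop_continuous g)).
    ctn.
  + move=> t t0; rewrite t0 (_ : 2 * t = 1); last by lra.
    by rewrite clamp0 clamp1 loop1 loop0.
- by rewrite /concat mulr0 ifT ?loop0 //; lra.
- rewrite /concat mulr1 ifF; last by apply/negbTE; lra.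
  by rewrite (_ : 2 - 1 = 1) ?loop1 //; lra.
Qed.

Definition concat_loop (f g : loop) := Loop (concat_is_loop f g).

Lemma rev_is_loop (f : loop) : is_loop (fun t => f (1 - t)).
Proof.
split; [|by rewrite subr0 loop1|by rewrite subrr loop0].
apply: (@within_of_continuous _ _ (fun t : R => f (1 - t))
  (fun t => f (clamp (1 - t)))).
  apply: (@continuous_compT _ _ _ (fun t : R => 1 - t) _ _ (@loop_continuous f)); ctn.
move=> t; rewrite /= in_itv /= => /andP[t0 t1].
by rewrite clampE //= in_itv /=; apply/andP; split; lra.
Qed.

Definition rev_loop (f : loop) := Loop (rev_is_loop f).

Lemma concat_homotopic f f' g g' : homotopic f f' -> homotopic g g' ->
  homotopic (concat_loop f g) (concat_loop f' g').
Proof.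
case/homotopicE=> K [[cK K0 K1 Kl Kr] Kc].
case/homotopicE=> L [[cL L0 L1 Ll Lr] Lc].
apply: (@homotopicI _ _
  (fun s t => if 2 * t - 1 <= 0 then K s (2 * t) else L s (2 * t - 1))).
- apply: (@glue_continuous _ (fun z : R * R => 2 * z.2 - 1) (fun z => K z.1 (2 * z.2))
    (fun z => L z.1 (2 * z.2 - 1))).
  + by ctn.
  + by apply: (@continuous_comp2 _ _ (fun z : R * R => z.1) (fun z => 2 * z.2)) cK _ _; ctn.
  + by apply: (@continuous_comp2 _ _ (fun z : R * R => z.1) (fun z => 2 * z.2 - 1)) cL _ _; ctn.
  + by move=> z z0; rewrite Kr ?Ll //; lra.
- move=> t It; rewrite /= concat_clamp //.
  by case: ifP => _; rewrite -1?Kc -1?Lc clamp0 ?K0 ?L0 //; exact: clampI.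
- move=> t It; rewrite /= concat_clamp //.
  by case: ifP => _; rewrite -1?Kc -1?Lc clamp1 ?K1 ?L1 //; exact: clampI.
- by move=> s _; rewrite mulr0 sub0r lerN10 Kl.
- by move=> s _; rewrite ifF ?Lr //; [lra|apply/negbTE; lra].
Qed.

Lemma rev_homotopic f f' : homotopic f f' -> homotopic (rev_loop f) (rev_loop f').
Proof.
case/homotopicE=> K [[cK K0 K1 Kl Kr] Kc].
apply: (@homotopicI _ _ (fun s t => K s (1 - t))).
- by apply: (@continuous_comp2 _ _ (fun z : R * R => z.1) (fun z => 1 - z.2)) cK _ _; ctn.
- move=> t; rewrite /= in_itv /= => /andP[t0 t1].
  by rewrite K0 //= in_itv /=; apply/andP; split; lra.
- move=> t; rewrite /= in_itv /= => /andP[t0 t1].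
  by rewrite K1 //= in_itv /=; apply/andP; split; lra.
- by move=> s _; rewrite subr0 Kr.
- by move=> s _; rewrite subrr Kl.
Qed.

Lemma reparam_homotopic (f g h : loop) (phi psi : R -> R) :
  continuous phi -> continuous psi -> phi 0 = psi 0 -> phi 1 = psi 1 ->
  (forall t, `[0, 1]%classic t -> g t = f (clamp (phi t))) ->
  (forall t, `[0, 1]%classic t -> h t = f (clamp (psi t))) ->
  homotopic g h.
Proof.
move=> cphi cpsi e0 e1 gE hE.
apply: (@homotopicI _ _ (fun s t => f (clamp (phi t + s * (psi t - phi t))))).
- apply: (@continuous_compT _ _ _
    (fun z : R * R => phi z.2 + z.1 * (psi z.2 - phi z.2)) (fun t => f (clamp t))).
    have cphi2 : continuous (fun z : R * R => phi z.2).
      by apply: continuous_compT cphi; ctn.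
    have cpsi2 : continuous (fun z : R * R => psi z.2).
      by apply: continuous_compT cpsi; ctn.
    by ctn.
  exact: loop_continuous.
- by move=> t It; rewrite mul0r addr0 gE.
- by move=> t It; rewrite mul1r addrC subrK hE.
- move=> s _; rewrite -e0 subrr mulr0 addr0 -gE ?loop0 //; exact: unit0.
- move=> s _; rewrite -e1 subrr mulr0 addr0 -gE ?loop1 //; exact: unit1.
Qed.

Ltac cases_maxmin :=
  rewrite /clamp /Order.max /Order.min /=; case_if idtac.

Lemma concat_cstl f : homotopic (concat_loop cst_loop f) f.
Proof.
apply: (@reparam_homotopic f _ _ (fun t => Num.max 0 (2 * t - 1)) id).
- by ctn.
- by ctn.
- by cases_maxmin; lra.
- by cases_maxmin; lra.
- move=> t; rewrite /= in_itv /= => /andP[t0 t1]; rewrite /concat.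
  case: ifP => t2; last by congr (f _); cases_maxmin; lra.
  by rewrite (_ : clamp _ = 0) ?loop0 //; cases_maxmin; lra.
- by move=> t It; rewrite clampE.
Qed.

Lemma concat_cstr f : homotopic (concat_loop f cst_loop) f.
Proof.
apply: (@reparam_homotopic f _ _ (fun t => Num.min 1 (2 * t)) id).
- by ctn.
- by ctn.
- by cases_maxmin; lra.
- by cases_maxmin; lra.
- move=> t; rewrite /= in_itv /= => /andP[t0 t1]; rewrite /concat.
  case: ifP => t2; first by congr (f _); cases_maxmin; lra.
  by rewrite (_ : clamp _ = 1) ?loop1 //; cases_maxmin; lra.
- by move=> t It; rewrite clampE.
Qed.

Lemma concat_revl f : homotopic (concat_loop (rev_loop f) f) cst_loop.
Proof.
apply: (@reparam_homotopic f _ _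
  (fun t => Num.max (1 - 2 * t) (2 * t - 1)) (fun=> 1)).
- by ctn.
- by ctn.
- by cases_maxmin; lra.
- by cases_maxmin; lra.
- move=> t; rewrite /= in_itv /= => /andP[t0 t1]; rewrite /concat /=.
  by case: ifP => t2; congr (f _); cases_maxmin; lra.
- by move=> t It; rewrite clamp1 loop1.
Qed.

Lemma concat_revr f : homotopic (concat_loop f (rev_loop f)) cst_loop.
Proof.
apply: (@reparam_homotopic f _ _
  (fun t => Num.min (2 * t) (2 - 2 * t)) (fun=> 0)).
- by ctn.
- by ctn.
- by cases_maxmin; lra.
- by cases_maxmin; lra.
- move=> t; rewrite /= in_itv /= => /andP[t0 t1]; rewrite /concat /=.
  by case: ifP => t2; congr (f _); cases_maxmin; lra.
- by move=> t It; rewrite clamp0 loop0.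
Qed.

Lemma concatA f g h : homotopic (concat_loop f (concat_loop g h))
  (concat_loop (concat_loop f g) h).
Proof.
apply: (@reparam_homotopic (concat_loop f (concat_loop g h)) _ _ id
  (fun t => Num.min (2 * t) (Num.min (t + 4^-1) (2^-1 * (t + 1))))).
- by ctn.
- by ctn.
- by cases_maxmin; lra.
- by cases_maxmin; lra.
- by move=> t It; rewrite clampE.
- move=> t; rewrite /= in_itv /= => /andP[t0 t1].
  rewrite clampE; last first.
    by rewrite /= in_itv /=; apply/andP; split; rewrite ?le_min ?ge_min; lra.
  rewrite /concat /=.
  have [t2|t2] := leP t 2^-1; last first.
    rewrite (min_r (_ : 2^-1 * (t + 1) <= t + 4^-1)); last by lra.
    rewrite min_r; last by lra.
    rewrite ifF; last by apply/negbTE; lra.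
    by rewrite ifF; [congr (h _); lra|apply/negbTE; lra].
  rewrite (min_l (_ : t + 4^-1 <= 2^-1 * (t + 1))); last by lra.
  have [t4|t4] := leP (2 * t) 2^-1.
    by rewrite min_l ?ifT //; lra.
  rewrite min_r; last by lra.
  rewrite ifF; last by apply/negbTE; lra.
  by rewrite ifT; [congr (g _); lra|lra].
Qed.

Lemma loop_classP f g : loop_class f = loop_class g <-> homotopic f g.
Proof.
split=> [/eqmodP /asboolP //|fg]; apply/eqmodP; exact/asboolP.
Qed.

Lemma repr_homotopic f : homotopic (repr (loop_class f)) f.
Proof. by apply/loop_classP; rewrite /loop_class reprK. Qed.

Definition pi1_mul (x y : fundamental_group) : fundamental_group :=
  loop_class (concat_loop (repr x) (repr y)).

Definition pi1_one : fundamental_group := loop_class cst_loop.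

Definition pi1_inv (x : fundamental_group) : fundamental_group :=
  loop_class (rev_loop (repr x)).

Lemma pi1_mulE f g :
  pi1_mul (loop_class f) (loop_class g) = loop_class (concat_loop f g).
Proof. by apply/loop_classP/concat_homotopic; exact: repr_homotopic. Qed.

Lemma pi1_invE f : pi1_inv (loop_class f) = loop_class (rev_loop f).
Proof. by apply/loop_classP/rev_homotopic; exact: repr_homotopic. Qed.

Lemma loop_class_surj x : exists f, x = loop_class f.
Proof. by exists (repr x); rewrite /loop_class reprK. Qed.

Lemma pi1_mulA : associative pi1_mul.
Proof.
move=> x y z; have [f ->] := loop_class_surj x.
have [g ->] := loop_class_surj y; have [h ->] := loop_class_surj z.
by rewrite !pi1_mulE; apply/loop_classP/concatA.
Qed.

Lemma pi1_mul1g : left_id pi1_one pi1_mul.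
Proof.
move=> x; have [f ->] := loop_class_surj x.
by rewrite pi1_mulE; apply/loop_classP/concat_cstl.
Qed.

Lemma pi1_mulg1 : right_id pi1_one pi1_mul.
Proof.
move=> x; have [f ->] := loop_class_surj x.
by rewrite pi1_mulE; apply/loop_classP/concat_cstr.
Qed.

Lemma pi1_mulVg : left_inverse pi1_one pi1_inv pi1_mul.
Proof.
move=> x; have [f ->] := loop_class_surj x.
by rewrite pi1_invE pi1_mulE; apply/loop_classP/concat_revl.
Qed.

Lemma pi1_mulgV : right_inverse pi1_one pi1_inv pi1_mul.
Proof.
move=> x; have [f ->] := loop_class_surj x.
by rewrite pi1_invE pi1_mulE; apply/loop_classP/concat_revr.
Qed.

HB.instance Definition _ := isGroup.Build fundamental_group
  pi1_mulA pi1_mul1g pi1_mulg1 pi1_mulVg pi1_mulgV.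

End FundamentalGroup.

Section CW.
Variable R : realType.

Definition disk n : set 'rV[R]_n := [set x | \sum_i x 0 i ^+ 2 <= 1].
Definition open_disk n : set 'rV[R]_n := [set x | \sum_i x 0 i ^+ 2 < 1].
Definition sphere n : set 'rV[R]_n := [set x | \sum_i x 0 i ^+ 2 = 1].

Arguments disk n : clear implicits.
Arguments open_disk n : clear implicits.
Arguments sphere n : clear implicits.

Record finite_CW_structure (B : topologicalType) := FiniteCWStructure {
  cell : finType;
  cell_dim : cell -> nat;
  char_map : forall e : cell, 'rV[R]_(cell_dim e) -> B;
  open_cell e := @char_map e @` open_disk (cell_dim e);
  char_map_continuous : forall e,
    {within disk (cell_dim e), continuous (@char_map e)};
  (* char_map e restricts to a homeomorphism from the open disk onto the
     open cell: it is injective and relatively open there *)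
  char_map_inj : forall e, set_inj (open_disk (cell_dim e)) (@char_map e);
  char_map_open : forall e U, open U -> U `<=` open_disk (cell_dim e) ->
    exists2 V, open V & @char_map e @` U = open_cell e `&` V;
  open_cell_partition : forall b, exists! e, open_cell e b;
  char_map_boundary : forall e, @char_map e @` sphere (cell_dim e) `<=`
    \bigcup_(e' in [set e' | (cell_dim e' < cell_dim e)%N]) open_cell e';
  closed_cellwise : forall A : set B,
    (forall e, closed (disk (cell_dim e) `&` @char_map e @^-1` A)) -> closed A }.

Definition finite_CW_complex (B : topologicalType) : Prop :=
  hausdorff_space B /\ inhabited (finite_CW_structure B).

End CW.

Section Covering.
Variables (X B : topologicalType) (q : X -> B).

(* The last condition says that q is an open map on each sheet, hence a
   homeomorphism onto U. *)
Definition evenly_covered (U : set B) : Prop := exists sheets : set (set X),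
  [/\ open U,
      q @^-1` U = \bigcup_(V in sheets) V,
      trivIset sheets id &
      forall V, sheets V ->
        [/\ open V, set_bij V U q &
            forall W, open W -> W `<=` V -> open (q @` W)]].

Definition covering_map : Prop :=
  [/\ continuous q, range q = setT &
      forall b, exists2 U, U b & evenly_covered U].

Definition deck_transformation : set (X -> X) :=
  [set h | [/\ continuous h, q \o h = q &
     exists g, [/\ continuous g, cancel h g & cancel g h]]].

Definition regular_covering (G : zmodType) : Prop :=
  [/\ connected [set: X], covering_map,
      forall x y, q x = q y -> exists2 h, deck_transformation h & h x = y &
      exists2 phi : G -> X -> X, set_bij setT deck_transformation phi &
        forall a b, phi (a + b) = phi a \o phi b].

End Covering.

(* Main.v *)
Require Import Defs.
From HB Require Import structures.
From mathcomp Require Import all_boot all_order all_algebra.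
From mathcomp Require Import all_classical all_reals.
From mathcomp Require Import ereal topology normedtype.
From mathcomp.multinomials Require Import freeg.
From mathcomp Require Import lra zify ring.
Set Implicit Arguments.
Unset Strict Implicit.
Unset Printing Implicit Defensive.
Import Order.TTheory GRing.Theory Num.Theory numFieldNormedType.Exports.
Local Open Scope classical_set_scope.
Local Open Scope ring_scope.

(* Let [G] be the fundamental group of [B], [pi : G -> F_p^r] the monodromy of
   the covering and [N] its kernel, the image of the fundamental group of [X].
   Since H_2(G; F_p) = 0, every 2-cocycle of [G] with values in F_p is a
   coboundary, so crossed homomorphisms with values in an F_p[G]-module that has
   a filtration with trivial quotients can be prescribed on any graded piece and
   lifted through the filtration one step at a time.  For the module of
   functions on F_p^r, filtered by the degree of reduced polynomials, this gives
   r p^r independent crossed homomorphisms.  By Shapiro's lemma, evaluation at 0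
   followed by restriction to [N] turns them into homomorphisms N -> F_p, and
   the crossed homomorphisms that die there are principal, hence form a space of
   dimension at most p^r - 1.  So dim Hom(N, F_p) >= (r - 1) p^r + 1 >= 2^r - 1
   when r > 0.  A homomorphism from the fundamental group of [X] to F_p is a
   singular 1-cocycle of [X], which detects the classes of loops. *)

(** * Cocycles and linear functionals *)

(** Zorn's lemma on linear relations: a maximal single-valued linear relation containing all pairs
    [(d u, phi u)] is the graph of a functional on all of [V], whatever the dimension. *)
Lemma linear_factor (F : fieldType) (U V : lmodType F) (d : {linear U -> V})
    (phi : {linear U -> F^o}) :
  (forall u, d u = 0 -> phi u = 0) ->
  exists psi : {linear V -> F^o}, forall u, phi u = psi (d u).
Proof.
move=> dphi.
pose graph : set (V * F^o) := [set (d u, phi u) | u in setT].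
(* The guard [A !=set0] lets the empty relation, the union of the empty chain, satisfy [P]. *)
pose P (A : set (V * F^o)) :=
  [/\ forall a x y, A x -> A y -> A (a *: x + y),
      forall c, A (0, c) -> c = 0 & A !=set0 -> graph `<=` A].
have Pgraph : P graph.
  split=> [a _ _ [u _ <-] [v _ <-]|c [u _ [/dphi + <-]] //|_ //].
  by exists (a *: u + v) => //; rewrite !linearP.
have [C CP Ctot|A [[Alin A0 Agraph] Amax]] := @Zorn_bigcup _ P.
  split.
  - move=> a x y [X CX Xx] [Y CY Yy].
    have [XY|YX] := Ctot _ _ CX CY.
    + by exists Y => //; have [+ _ _] := CP _ CY; apply => //; exact: XY.
    + by exists X => //; have [+ _ _] := CP _ CX; apply => //; exact: YX.
  - by move=> c [X CX Xc]; have [_ + _] := CP _ CX; exact.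
  - move=> [x [X CX Xx]] y gy; exists X => //.
    by have [_ _ +] := CP _ CX; apply => //; exists x.
have Agr : graph `<=` A.
  apply: Agraph; apply: contrapT => /set0P/negP/negPn/eqP A_eq0.
  apply: (Amax graph) => //; rewrite A_eq0; split => // /(_ (d 0, phi 0)).
  by apply; exists 0.
have A00 : A (0, 0) by apply: Agr; exists 0; rewrite ?linear0.
have Auniq v c c' : A (v, c) -> A (v, c') -> c = c'.
  move=> vc vc'; apply/subr0_eq/A0.
  have := Alin (-1) _ _ vc' vc.
  by rewrite -[_ + _]/(_ *: v + v, _ *: c' + c) !scaleN1r addNr addrC.
have Atot v : exists c, A (v, c).
  apply: contrapT => noc.
  (* Sending [v] to 0 enlarges the relation; it stays single-valued because no nonzero multiple of
     [v] lies in the domain of [A]. *)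
  pose A' : set (V * F^o) := [set (x.1 + a *: v, x.2) | x in A & a in setT].
  have AA' : A `<=` A'.
    by move=> x Ax; exists x => //; exists 0; rewrite // scale0r addr0; case: x Ax.
  have vA' : A' (v, 0) by exists (0, 0) => //; exists 1; rewrite //= scale1r add0r.
  apply: (Amax A').
    by split => // /(_ _ vA') v0; apply: noc; exists 0.
  split.
  - move=> a _ _ [x Ax [b _ <-]] [y Ay [c _ <-]].
    exists (a *: x + y); first exact: Alin.
    exists (a * b + c) => //=.
    by congr pair; rewrite /= scalerDl -scalerA scalerDr addrACA.
  - move=> c [[x e] Axe [a _ /= [xa <-]]].
    have [a0|a0] := eqVneq a 0.
      by apply: A0; move: Axe xa; rewrite a0 scale0r addr0 => + <-.
    case: noc; exists (- a^-1 * e).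
    have := Alin (- a^-1) _ _ Axe A00.
    rewrite addr0; congr A; congr pair.
    move: xa => /eqP; rewrite addr_eq0 => /eqP ->.
    by rewrite scaleNr scalerN opprK scalerA mulVf // scale1r.
  - by move=> _; exact: subset_trans AA'.
have [psi psiP] := choice Atot.
have psi_lin : linear (psi : V -> F^o).
  by move=> a u v; apply: Auniq (psiP _) _; exact: (Alin a (_, _) (_, _)).
pose psiM := GRing.isLinear.Build _ _ _ _ (psi : V -> F^o) psi_lin.
pose psiL : {linear V -> F^o} := HB.pack (psi : V -> F^o) psiM.
by exists psiL => u /=; apply: Auniq (psiP _); apply: Agr; exists u.
Qed.

Section FreegLinear.
Variables (F : fieldType) (K : choiceType) (M : lmodType F) (f : K -> M).

Lemma fglift_linear : linear (fglift f).
Proof.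
have fD := @lift_is_additive F K M f.
have f0 : fglift f 0 = 0 by rewrite -(subrr 0) fD subrr.
have fB x y : fglift f (x + y) = fglift f x + fglift f y.
  by rewrite -[y]opprK -[- y]sub0r !fD f0 !sub0r !opprK.
have fZ a u : fglift f (a *: u) = a *: fglift f u.
  rewrite -{2}[u]freeg_sumE -[LHS]/(fglift f (fgscale a u)) /fgscale.
  elim/big_ind2: _ => [|x x' y y' ex ey|i _]; first by rewrite f0 scaler0.
    by rewrite fB ex ey fB scalerDr.
  by rewrite !liftU scalerA.
by move=> a u v; rewrite fB fZ.
Qed.

HB.instance Definition _ := GRing.isLinear.Build F {freeg K / F} M _ (fglift f) fglift_linear.
End FreegLinear.

Lemma liftU1 (F : fieldType) (K : choiceType) (M : lmodType F) (f : K -> M) x :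
  fglift f << x >> = f x.
Proof. by rewrite liftU scale1r. Qed.

HB.instance Definition _ (F : fieldType) (S : semisimplicial) n :=
  GRing.Linear.copy (@boundary F S n) (fglift _).

Lemma chain_ext (F : fieldType) (S : semisimplicial) n (M : lmodType F)
    (f g : {linear chain F S n -> M}) :
  (forall x, f << x >> = g << x >>) -> f =1 g.
Proof.
move=> fg u; rewrite -[u]freeg_sumE !linear_sum; apply: eq_bigr => x _.
have -> : << coeff x u *g x >> = coeff x u *: << x >> :> chain F S n.
  by apply/eqP/freeg_eqP => y; rewrite coeffZ !coeffU mul1r.
by rewrite !linearZ fg.
Qed.

Lemma boundaryU (F : fieldType) (S : semisimplicial) n (x : S n.+1) :
  boundary << x >> = \sum_(i < n.+2) (-1) ^+ i *: << face i x >> :> chain F S n.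
Proof. exact: liftU1. Qed.

(** Universal coefficients over a field: a cocycle kills boundaries, hence all cycles when the
    homology vanishes, so it factors through [boundary]. *)
Lemma cocycle_coboundary (F : fieldType) (S : semisimplicial) n
    (phi : S n.+1 -> F) :
  homology_eq0 F S n.+1 ->
  (forall x : S n.+2, \sum_(i < n.+3) (-1) ^+ i * phi (face i x) = 0) ->
  exists psi : S n -> F,
    forall x, phi x = \sum_(i < n.+2) (-1) ^+ i * psi (face i x).
Proof.
move=> H0 phi0.
have phid : (fglift (phi : S n.+1 -> F^o) \o @boundary F S n.+1) =1 \0.
  apply: (@chain_ext F S n.+2 F^o) => x.
  rewrite [LHS]/= boundaryU linear_sum -[RHS]/(0 : F) -[RHS](phi0 x).
  by apply: eq_bigr => i _; rewrite linearZ /= liftU1.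
have [u /H0[v _ <-]|psi psiP] :=
  @linear_factor F _ _ (@boundary F S n) (fglift (phi : S n.+1 -> F^o)).
  exact: phid.
exists (fun y => psi << y >>) => x.
rewrite -[LHS](@liftU1 F _ F^o phi) psiP /= boundaryU linear_sum.
by apply: eq_bigr => i _; rewrite linearZ.
Qed.

(** Vanishing of H_2 becomes vanishing of H^2, in the inhomogeneous form in which obstructions to
    crossed homomorphisms arise. *)
Lemma nerve_cocycle_coboundary (F : fieldType) (G : groupType)
    (c : G -> G -> F) :
  homology_eq0 F (nerve G) 2 ->
  (forall g h k, c h k - c (g * h)%g k + c g (h * k)%g - c g h = 0) ->
  exists u : G -> F, forall g h, c g h = u h - u (g * h)%g + u g.
Proof.
move=> H0 c0; pose o0 : 'I_2 := ord0; pose o1 : 'I_2 := ord_max.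
pose phi (x : nerve G 2) := c (x o0) (x o1).
have [|psi psiP] := @cocycle_coboundary F (nerve G) 1 phi H0.
  move=> x; rewrite -[RHS](c0 (x (inord 0)) (x (inord 1)) (x (inord 2))).
  rewrite !big_ord_recl big_ord0 /= /phi /= !ffunE /=.
  by rewrite /bump /=; ring.
exists (fun g => psi [ffun=> g]) => g h.
have := psiP [ffun i : 'I_2 => if i == ord0 then g else h].
rewrite /phi !ffunE /= => ->.
have nf (i : 'I_3) : nerve_face i [ffun i : 'I_2 => if i == ord0 then g else h]
    = [ffun=> if (i < 1)%N then h else if i == 1%N :> nat then (g * h)%g else g].
  apply/ffunP => k; rewrite ord1 !ffunE /= -!val_eqE /= !inordE /=.
  by case: i => -[|[|[]]].
by rewrite !big_ord_recl big_ord0 /= !nf /= /bump /=; ring.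
Qed.

(** * Crossed homomorphisms *)

Section CrossedHomomorphisms.
Variables (F : fieldType) (G : groupType) (I : finType) (deg : I -> nat).
Variable K : G -> I -> I -> F.
Hypothesis K_mul :
  forall g h a c, K (g * h)%g a c = \sum_b K g a b * K h b c.
Hypothesis K_tri : forall g a b, (deg b <= deg a)%N -> K g a b = (a == b)%:R.

(** These are the 1-cocycles for the action of [G] on column vectors by the matrices [K g]. By
    [K_tri], the vectors supported in degrees at most a given bound form a submodule, and [G] acts
    trivially on the graded quotients. *)
Definition crossed (f : G -> I -> F) :=
  forall g h a, f (g * h)%g a = f g a + \sum_b K g a b * f h b.

Lemma sum_unitriangular g a d (x : I -> F) : (d <= deg a)%N ->
  \sum_(b | (d <= deg b)%N) K g a b * x b =
  x a + \sum_(b | (deg a < deg b)%N) K g a b * x b.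
Proof.
move=> da; rewrite (bigID (fun b => deg a < deg b)%N) /= addrC; congr (_ + _).
  rewrite (bigD1 a) ?ltnn ?andbT //= K_tri // eqxx mul1r big1 ?addr0 // => b.
  by rewrite -leqNgt => /andP[/andP[_ ba] /negbTE nab]; rewrite K_tri // eq_sym nab mul0r.
apply: eq_bigl => b; case: (ltnP (deg a) (deg b)) => [/ltnW ab|]; last by rewrite andbF.
by rewrite (leq_trans da).
Qed.

Lemma crossed_with_leading_term (k : I) (chi : G -> F) :
  (forall c : G -> G -> F,
     (forall g h k, c h k - c (g * h)%g k + c g (h * k)%g - c g h = 0) ->
     exists u : G -> F, forall g h, c g h = u h - u (g * h)%g + u g) ->
  (forall g h, chi (g * h)%g = chi g + chi h) ->
  exists2 f, crossed f & forall g,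
    f g k = chi g /\ forall j, (deg k <= deg j)%N -> j != k -> f g j = 0.
Proof.
move=> H2 chiM.
have K_sum g a (x : I -> F) :
    \sum_b K g a b * x b = x a + \sum_(b | (deg a < deg b)%N) K g a b * x b.
  by rewrite -(@sum_unitriangular g a 0).
(* The coordinates are constructed by decreasing degree; the obstruction to the
   next one is a 2-cocycle with trivial coefficients. *)
suff step n : exists f : G -> I -> F,
    (forall g h a, (deg k <= n + deg a)%N ->
       f (g * h)%g a = f g a + \sum_b K g a b * f h b) /\
    forall g, f g k = chi g /\ forall j, (deg k <= deg j)%N -> j != k -> f g j = 0.
  have [f [fc fl]] := step (deg k); exists f => // g h a.
  by apply: fc; rewrite leq_addr.
elim: n => [|n [f [fc fl]]].
  exists (fun g a => chi g *+ (a == k)); split=> [g h a ka|g]; last first.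
    by rewrite eqxx; split=> // j _ /negbTE ->.
  rewrite (bigD1 k) //= big1 => [|b /negbTE ->]; last by rewrite mulr0n mulr0.
  rewrite eqxx K_tri // addr0 chiM mulrnDl.
  by case: eqP => _; rewrite ?mul1r ?mul0r.
(* In the first case every coordinate is already treated; in the second [d], free of truncation, is
   the next degree to fill. *)
have [kn|nk] := leqP (deg k) n.
  by exists f; split=> // g h a _; apply: fc; rewrite (leq_trans kn) ?leq_addr.
pose d := (deg k - n.+1)%N.
have dk : (d < deg k)%N by lia.
have fcd g h a : (d < deg a)%N -> f (g * h)%g a = f g a + \sum_b K g a b * f h b.
  by move=> ?; apply: fc; lia.
pose c a g h := \sum_(b | (d < deg b)%N) K g a b * f h b.
have /choice[u uP] a : exists u : G -> F, deg a = d ->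
    forall g h, c a g h = u h - u (g * h)%g + u g.
  have [ad|ad] := eqVneq (deg a) d; last first.
    by exists (fun=> 0) => /eqP; rewrite (negbTE ad).
  have [g h l|u uP] := H2 (c a); last by exists u.
  (* Cocycle identity for [c a]: expanding [K (g * h)] and [f (h * l)] produces the same double sum,
     which cancels. *)
  have E1 : c a (g * h)%g l = c a h l +
      \sum_(b | (d < deg b)%N) \sum_(e | (d < deg e)%N) K g a b * K h b e * f l e.
    rewrite exchange_big -big_split; apply: eq_bigr => e de /=.
    by rewrite K_mul K_sum ad mulrDl mulr_suml.
  have E2 : c a g (h * l)%g = c a g h +
      \sum_(b | (d < deg b)%N) \sum_(e | (d < deg e)%N) K g a b * K h b e * f l e.
    rewrite -big_split; apply: eq_bigr => b db /=.
    rewrite fcd // K_sum -(@sum_unitriangular h b d.+1) // mulrDr mulr_sumr.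
    by congr (_ + _); apply: eq_bigr => e _; rewrite mulrA.
  by rewrite E1 E2; ring.
(* The new coordinate must satisfy f(gh) = f(g) + f(h) + c(g, h), whereas c(g, h) = u(h) - u(gh) +
   u(g); hence the sign. *)
exists (fun g a => if deg a == d then - u a g else f g a); split=> [g h a ka|g].
  have sumE b : (d <= deg b)%N -> \sum_(e | (deg b < deg e)%N) K g b e *
      (if deg e == d then - u e h else f h e) =
      \sum_(e | (deg b < deg e)%N) K g b e * f h e.
    by move=> db; apply: eq_bigr => e be; rewrite ifF //; apply/eqP; lia.
  rewrite K_sum sumE; last by lia.
  case: eqP => ad; last by rewrite -K_sum fcd //; lia.
  by rewrite ad -/(c a g h) (uP _ ad); ring.
rewrite ifF; last by apply/eqP; lia.
have [-> fl0] := fl g; split=> // j kj jk; rewrite ifF ?fl0 //.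
by apply/eqP; lia.
Qed.

End CrossedHomomorphisms.

(** * Translations of reduced polynomials *)

Section Translations.
Variable F : fieldType.

(** The matrix of X -> X + a in the monomial basis: the entry is binom(j, i) a^(j - i) for i <= j,
    and 0 otherwise. *)
Definition translation_coef (a : F) (i j : nat) : F := (('X + a%:P) ^+ j)`_i.

Lemma size_translate_exp (a : F) j : size (('X + a%:P) ^+ j) = j.+1.
Proof. by rewrite -[a]opprK polyCN size_exp_XsubC. Qed.

Lemma translation_coefD n (a b : F) i j : (j < n)%N ->
  translation_coef (a + b) i j =
  \sum_(k < n) translation_coef a i k * translation_coef b k j.
Proof.
move=> jn; pose q := ('X + b%:P) ^+ j.
have -> : translation_coef (a + b) i j = (q \Po ('X + a%:P))`_i.
  by rewrite rmorphXn /= rmorphD /= comp_polyX comp_polyC -addrA -polyCD.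
rewrite comp_polyE coef_sum size_translate_exp -(subnKC jn) big_split_ord /=.
symmetry; rewrite addrC big1 ?add0r => [|k _]; last first.
  rewrite /translation_coef; rewrite [q in _ * q]nth_default ?mulr0 //.
  by rewrite size_translate_exp leq_addr.
by apply: eq_bigr => k _; rewrite coefZ mulrC.
Qed.

Lemma translation_coef_lt (a : F) i j : (j < i)%N -> translation_coef a i j = 0.
Proof. by move=> ji; rewrite /translation_coef nth_default ?size_translate_exp. Qed.

Lemma translation_coef_id (a : F) i : translation_coef a i i = 1.
Proof.
have /monicP : ('X + a%:P) ^+ i \is monic by rewrite monic_exp // -[a]opprK polyCN monicXsubC.
by rewrite lead_coefE size_translate_exp.
Qed.

Lemma translation_coef0 (a : F) j : translation_coef a 0 j = a ^+ j.
Proof. by rewrite /translation_coef -horner_coef0 horner_exp !hornerE. Qed.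

Variables r n : nat.
Implicit Types (a b : 'rV[F]_r) (x y z : {ffun 'I_r -> 'I_n}).

(* The coefficient of the monomial X^x in (X + a)^y. *)
Definition translation_mx a x y : F :=
  \prod_i translation_coef (a 0 i) (x i) (y i).

Definition multidegree x := (\sum_i x i)%N.

Lemma translation_mxD a b x z :
  translation_mx (a + b) x z = \sum_y translation_mx a x y * translation_mx b y z.
Proof.
rewrite /translation_mx.
under eq_bigr => i _ do rewrite mxE (translation_coefD _ _ _ (ltn_ord (z i))).
by rewrite bigA_distr_bigA; apply: eq_bigr => y _; rewrite big_split.
Qed.

(** Either [x <= y] in every coordinate, and the degree bound forces equality, or some coordinate of
    [x] exceeds that of [y] and its factor vanishes. *)
Lemma translation_mx_tri a x y :
  (multidegree y <= multidegree x)%N -> translation_mx a x y = (x == y)%:R.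
Proof.
move=> yx; have [/forallP xy|] := boolP [forall i, x i <= y i]%N.
  have e i : x i = y i.
    apply/val_inj/eqP; rewrite eqn_leq xy leqNgt; apply/negP => lti.
    move: yx; rewrite leqNgt => /negP; apply.
    rewrite /multidegree (bigD1 i) //= [leqRHS](bigD1 i) //=.
    by rewrite -addSn leq_add // leq_sum.
  have -> : x = y by apply/ffunP.
  by rewrite eqxx /translation_mx big1 // => i _; exact: translation_coef_id.
rewrite negb_forall => /existsP[i]; rewrite -ltnNge => lti.
rewrite /translation_mx (bigD1 i) //= translation_coef_lt // mul0r.
by case: eqP => // xy; rewrite xy ltnn in lti.
Qed.

Lemma translation_mx0 x y : translation_mx 0 x y = (x == y)%:R.
Proof.
have [<-|xy] := eqVneq x y; first by rewrite translation_mx_tri ?eqxx.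
have [i xyi] : exists i, x i != y i.
  apply/existsP; rewrite -negb_forall; apply: contra xy => /forallP xy.
  by apply/eqP/ffunP => i; apply/eqP.
rewrite /translation_mx (bigD1 i) //= mxE /translation_coef addr0 coefXn.
by rewrite (inj_eq val_inj) (negbTE xyi) mul0r.
Qed.

(** A polynomial of degree less than [n] in each variable is determined by its values on the grid of
    the [n] distinct scalars [s], by inverting a Vandermonde matrix in each variable. *)
Lemma reduced_monomials_free (s : 'I_n -> F) (c : {ffun 'I_r -> 'I_n} -> F) :
  injective s ->
  (forall a : 'rV[F]_r,
     \sum_(y : {ffun 'I_r -> 'I_n}) (\prod_i a 0 i ^+ y i) * c y = 0) ->
  forall y, c y = 0.
Proof.
move=> s_inj c0 x.
pose V := Vandermonde n (\row_j s j).
have Vu : V \in unitmx.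
  rewrite unitmxE unitfE det_Vandermonde; apply/prodf_neq0 => i _.
  apply/prodf_neq0 => j ij; rewrite !mxE subr_eq0.
  by apply: contraTneq ij => /s_inj ->; rewrite ltnn.
have VW (i k : 'I_n) : \sum_j s j ^+ i * invmx V j k = (i == k)%:R.
  have /matrixP/(_ i k) := mulmxV Vu; rewrite !mxE => <-.
  by apply: eq_bigr => j _; rewrite !mxE.
(* Weighting the grid values by products of entries of the inverse Vandermonde matrix isolates the
   coefficient of index [x]. *)
have : \sum_(f : {ffun 'I_r -> 'I_n}) (\prod_i invmx V (f i) (x i)) *
   \sum_(y : {ffun 'I_r -> 'I_n}) (\prod_i (\row_i s (f i)) 0 i ^+ y i) * c y = 0.
  by rewrite big1 // => f _; rewrite c0 mulr0.
under eq_bigr do rewrite mulr_sumr.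
rewrite exchange_big /= (bigD1 x) //= [X in _ + X]big1 ?addr0 => [|y yx].
  under eq_bigr do rewrite mulrA -big_split.
  rewrite -mulr_suml /=; under eq_bigr do under eq_bigr do rewrite mxE mulrC.
  rewrite -(bigA_distr_bigA (fun i j => s j ^+ x i * invmx V j (x i))).
  by rewrite big1 ?mul1r // => i _; rewrite VW eqxx.
under eq_bigr do rewrite mulrA -big_split.
rewrite -mulr_suml /=; under eq_bigr do under eq_bigr do rewrite mxE mulrC.
rewrite -(bigA_distr_bigA (fun i j => s j ^+ y i * invmx V j (x i))).
have [i yxi] : exists i, y i != x i.
  apply/existsP; rewrite -negb_forall; apply: contra yx => /forallP yx.
  by apply/eqP/ffunP => i; apply/eqP.
by rewrite (bigD1 i) //= VW (negbTE yxi) !mul0r.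
Qed.

End Translations.

(** * Independent characters of the kernel of the monodromy *)

(** Greedy choice: while m + d < k, the [m] rows already chosen and the [d] rows of [W] kill a
    common nonzero vector. By hypothesis some element of [S] does not kill it, and is therefore
    independent of the chosen rows. *)
Lemma exists_free_rows (F : fieldType) k d (S : set 'rV[F]_k) (W : 'M[F]_(d, k)) :
  (forall c : 'cV_k, (forall v, S v -> v *m c = 0) -> W *m c = 0 -> c = 0) ->
  forall m, (m <= k - d)%N ->
  exists E : 'M[F]_(m, k), (forall i, S (row i E)) /\ row_free E.
Proof.
move=> SW; elim=> [|m IHm] mk.
  by exists 0; split=> [[]|] //; rewrite /row_free mxrank0.
have [E [SE Efree]] := IHm (ltnW mk).
have : kermx (col_mx E W)^T != 0.
  rewrite -mxrank_eq0 mxrank_ker mxrank_tr -lt0n subn_gt0.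
  by rewrite (leq_ltn_trans (rank_leq_row _)) //; lia.
move=> /rowV0Pn[u /sub_kermxP uE u0].
have /eq_col_mx[Eu Wu] : col_mx (E *m u^T) (W *m u^T) = col_mx 0 0.
  by rewrite -mul_col_mx -[LHS]trmxK trmx_mul trmxK uE trmx0 col_mx0.
have [v Sv vu] : exists2 v, S v & v *m u^T != 0.
  apply: contrapT => noS; move/eqP: u0; apply.
  apply: trmx_inj; rewrite trmx0; apply: SW => // v Sv.
  by apply/eqP/negP => /negP vu; apply: noS; exists v.
exists (col_mx v E : 'M_(1 + m, k)); split=> [i|].
  case: (@split_ordP 1 m i) => j ->; last by rewrite (@rowKd _ 1 m k j v E).
  by rewrite (@rowKu _ 1 m k j v E) ord1 row_id.
apply: inj_row_free => w; rewrite -[w](@hsubmxK _ 1 1 m).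
move: (@lsubmx _ 1 1 m w) (@rsubmx _ 1 1 m w) => {w} a b.
rewrite (@mul_row_col _ 1 1 m k) => wE.
have a0 : a = 0.
  have : (a *m v + b *m E) *m u^T = 0 by rewrite wE mul0mx.
  rewrite mulmxDl -!mulmxA Eu mulmx0 addr0 [a]mx11_scalar mul_scalar_mx.
  move/eqP; rewrite scalemx_eq0 (negbTE vu) orbF => /eqP ->.
  by rewrite raddf0.
move: wE; rewrite a0 mul0mx add0r => /eqP.
by rewrite mulmx_free_eq0 // => /eqP ->; rewrite row_mx0.
Qed.

(** Equality holds for r = 0 and r = 1; from r = 2 on, r p^r >= 2 p^r makes the right side exceed
    p^r. *)
Lemma rank_bound p r : (1 < p)%N -> (2 ^ r - 1 <= r * p ^ r - (p ^ r).-1)%N.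
Proof.
move=> p1; case: r => [//|r].
have p2 : (2 ^ r.+1 <= p ^ r.+1)%N by rewrite leq_exp2r.
have p0 : (0 < p ^ r.+1)%N by rewrite expn_gt0 ltnW.
case: r p2 p0 => [|r] p2 p0; first by rewrite !expn1 mul1n; lia.
have : (2 * p ^ r.+2 <= r.+2 * p ^ r.+2)%N by rewrite leq_mul2r orbT.
lia.
Qed.

(** The functions [theta j] are additive only on the kernel of [pi]. Independence is stated through
    the pairing matrix, which is what certifies independent homology classes later. *)
Lemma free_kernel_characters (p r : nat) (G : groupType)
    (pi : G -> 'rV['F_p]_r) :
  prime p -> homology_eq0 'F_p (nerve G) 2 ->
  (forall g h, pi (g * h)%g = pi g + pi h) -> (forall a, exists g, pi g = a) ->
  exists k (theta : 'I_k -> G -> 'F_p) (x : 'I_(2 ^ r - 1) -> G),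
    [/\ forall j g h, pi g = 0 -> pi h = 0 ->
          theta j (g * h)%g = theta j g + theta j h,
        forall i, pi (x i) = 0 &
        row_free (\matrix_(i, j) theta j (x i))].
Proof.
move=> p_pr H2 piM /choice[ga gaP].

(* Exponents of the reduced monomials, which form a basis of the functions on F_p^r; [K] is the
   translation action on them. *)
pose I := {ffun 'I_r -> 'I_p}.
pose K g : I -> I -> 'F_p := translation_mx (pi g).
have K_mul g h a c : K (g * h)%g a c = \sum_b K g a b * K h b c.
  by rewrite /K piM translation_mxD.
have K_tri g (a b : I) : (multidegree b <= multidegree a)%N -> K g a b = (a == b)%:R.
  exact: translation_mx_tri.
have K0 g a b : pi g = 0 -> K g a b = (a == b)%:R.
  by move=> g0; rewrite /K g0 translation_mx0.
(* One crossed homomorphism for each coordinate of [pi] and each monomial, r p^r in all. *)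
have /choice[f fP] (la : 'I_r * I) : exists f, crossed K f /\ forall g,
    f g la.2 = pi g 0 la.1 /\
    forall j, (multidegree la.2 <= multidegree j)%N -> j != la.2 -> f g j = 0.
  have [||f fc fl] := crossed_with_leading_term K_mul K_tri la.2 (chi := fun g => pi g 0 la.1).
  - by move=> c; exact: nerve_cocycle_coboundary.
  - by move=> g h; rewrite piM mxE.
  - by exists f.
pose z : I := [ffun=> Ordinal (prime_gt0 p_pr)].
have Kz g b : K g z b = \prod_i pi g 0 i ^+ b i.
  by apply: eq_bigr => i _; rewrite ffunE translation_coef0.
pose k := #|{: 'I_r * I}|.
pose e g : 'rV['F_p]_k := \row_j f (enum_val j) g z.
(* There are p^r - 1 rows, one for each nonzero [a]; the point 0 is represented by an element of the
   kernel, already covered by [S]. *)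
pose W : 'M_(#|predC1 (0 : 'rV['F_p]_r)|, k) := \matrix_i e (ga (enum_val i)).
pose S := [set e g | g in [set g | pi g = 0]].
(* A combination [y] of the crossed homomorphisms whose value at 0 vanishes on the kernel and on
   coset representatives vanishes altogether; its leading terms then give [c = 0]. *)
have SW (c : 'cV_k) : (forall v, S v -> v *m c = 0) -> W *m c = 0 -> c = 0.
  move=> Sc Wc.
  pose C la := c (enum_rank la) 0.
  pose y g b := \sum_la f la g b * C la.
  have yc : crossed K y.
    move=> g h a; rewrite /y.
    rewrite [X in _ + X](eq_bigr (fun b => \sum_la K g a b * (f la h b * C la))).
      rewrite exchange_big -big_split; apply: eq_bigr => la _ /=.
      have [fc _] := fP la; rewrite fc mulrDl mulr_suml.
      by congr (_ + _); apply: eq_bigr => b _; rewrite mulrA.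
    by move=> b _; rewrite mulr_sumr.
  have yE g : y g z = (e g *m c) 0 0.
    rewrite mxE /y (reindex (enum_val : 'I_k -> _)) /=.
      by apply: eq_bigr => j _; rewrite mxE /C enum_valK.
    exact/onW_bij/enum_val_bij.
  have yker g : pi g = 0 -> y g z = 0.
    by move=> g0; rewrite yE Sc ?mxE //; exists g.
  have ytrans a : y (ga a) z = 0.
    have [->|a0] := eqVneq a 0; first exact/yker/gaP.
    have ka : a \in predC1 (0 : 'rV['F_p]_r) by [].
    have /rowP/(_ 0) := congr1 (row (enum_rank_in ka a)) Wc.
    by rewrite row_mul rowK enum_rankK_in // yE => ->; rewrite row0 mxE.
  (* [z] is the exponent 0, so [y g z] is the value at 0 of the function [y g]. *)
  have yz g : y g z = 0.
    pose n := (g * (ga (pi g))^-1)%g.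
    have -> : g = (n * ga (pi g))%g by rewrite mulgVK.
    have n0 : pi n = 0.
      by apply: (addIr (pi (ga (pi g)))); rewrite -piM /n mulgVK gaP add0r.
    rewrite yc yker // add0r (bigD1 z) //= K0 // eqxx mul1r ytrans add0r.
    by apply: big1 => b bz; rewrite K0 // eq_sym (negbTE bz) mul0r.
  (* The crossed identity for [ga a * g] shows that the function [y g] has value 0 at every [a]. *)
  have y0 g b : y g b = 0.
    apply: (@reduced_monomials_free _ r p (fun j => j%:R) (y g)) => [i j|a].
      move/(congr1 val); rewrite /= !val_Fp_nat // !modn_small // => ij.
      exact: val_inj.
    have := yc (ga a) g z; rewrite !yz add0r => E; rewrite [RHS]E.
    by apply: eq_bigr => b' _; rewrite Kz gaP.
  (* Descending induction on the degree of [a], which is at most r p: once the coefficients of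
     higher degree vanish, only the leading terms at [a] contribute to the coordinate [a] of [y]. *)
  suff C0 m (a : I) l : (r * p < multidegree a + m)%N -> C (l, a) = 0.
    apply/colP => j; rewrite mxE -[j]enum_valK; case: (enum_val j) => l a.
    by apply: (C0 (r * p).+1); rewrite ltn_addl.
  elim: m a l => [|m IHm] a l.
    rewrite addn0 ltnNge => /negP[]; rewrite -[X in (_ <= X * _)%N]card_ord -sum_nat_const.
    by apply: leq_sum => i _; exact/ltnW.
  move=> am.
  (* A preimage under [pi] of the basis vector of index [l] isolates [C (l, a)]. *)
  suff : \sum_l' (delta_mx 0 l : 'rV_r) 0 l' * C (l', a) = 0.
    rewrite (bigD1 l) //= mxE !eqxx mul1r big1 ?addr0 // => l' /negbTE ll'.
    by rewrite mxE ll' andbF mul0r.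
  rewrite -[RHS](y0 (ga (delta_mx 0 l)) a) /y.
  set g := ga _; pose H l b := f (l, b) g a * C (l, b).
  rewrite [RHS](eq_bigr (fun la => H la.1 la.2)) => [|[] //].
  rewrite -(pair_bigA _ H) /H /=.
  apply: eq_bigr => l' _; rewrite (bigD1 a) //= big1 => [|b ba].
    by have [_ /(_ g)[/= -> _]] := fP (l', a); rewrite gaP addr0.
  have [ab|ab] := ltnP (multidegree a) (multidegree b).
    by rewrite IHm ?mulr0 //; lia.
  have [_ /(_ g)[/= _ ->]] := fP (l', b) => //.
    by rewrite mul0r.
  by rewrite eq_sym.
have [|E [SE Efree]] := exists_free_rows SW (m := (2 ^ r - 1)%N).
  rewrite /k card_prod card_ffun !card_ord cardC1 card_mx card_Fp // mul1n.
  exact/rank_bound/prime_gt1.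
have /choice[x xP] i : exists x, pi x = 0 /\ e x = row i E.
  by have [g g0 <-] := SE i; exists g.
exists k, (fun j g => f (enum_val j) g z), x; split=> [j g h g0 h0|i|].
- have [fc _] := fP (enum_val j).
  rewrite fc (bigD1 z) //= K0 // eqxx mul1r big1 ?addr0 // => b bz.
  by rewrite K0 // eq_sym (negbTE bz) mul0r.
- by have [] := xP i.
- suff -> : \matrix_(i, j) f (enum_val j) (x i) z = E by [].
  apply/row_matrixP => i; have [_ <-] := xP i.
  by apply/rowP => j; rewrite !mxE.
Qed.

(** * Singular simplices and loops *)

Ltac continuity := first [ assumption | lazymatch goal with
  | |- continuous (fun x => @?f x + @?g x) => apply: (@fun_continuousD _ _ f g); continuity
  | |- continuous (fun x => - @?f x) => apply: (@fun_continuousN _ _ f); continuity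
  | |- continuous (fun x => @?f x * @?g x) => apply: (@fun_continuousM _ _ f g); continuity
  | |- continuous (fun x => Num.max (@?f x) (@?g x)) =>
      apply: (@fun_continuous_max _ _ f g); continuity
  | |- continuous (fun x => Num.min (@?f x) (@?g x)) =>
      apply: (@fun_continuous_min _ _ f g); continuity
  | |- continuous (fun x => (@?f x, @?g x)) =>
      apply: (@fun_continuous_pair _ _ _ f g); continuity
  | |- continuous (fun _ => ?c) => exact: fun_continuous_cst
  | |- continuous (fun x => x) => exact: fun_continuous_id
  | |- continuous (fun x => x.1) => exact: fun_continuous_fst
  | |- continuous (fun x => x.2) => exact: fun_continuous_snd
  | |- _ => first
      [ exact: fun_continuous_id | exact: fun_continuous_fst
      | exact: fun_continuous_snd ]
  end ].

Ltac case_max := rewrite ?/clamp ?/Order.max ?/Order.min /=;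
  repeat match goal with
  |- context [if ?b then _ else _] =>
    lazymatch b with
    | context [if _ then _ else _] => fail
    | _ => case: (boolP b) => ?
    end
  end.

Lemma fun_continuous_ext (X Y : topologicalType) (f g : X -> Y) :
  f =1 g -> continuous f -> continuous g.
Proof. by move=> /funext ->. Qed.

Section PlaneHomotopies.
Variables (R : realType) (T : topologicalType).

Lemma fun_continuous_row (Y : topologicalType) n (f : Y -> 'rV[R]_n) :
  (forall j, continuous (fun y => f y 0 j)) -> continuous f.
Proof.
move=> cf y A [P Px PA].
have near_all : \forall x \near y, forall j, P 0 j (f x 0 j).
  by apply: filter_forall => j; apply: cf; exact: Px.
apply: filterS near_all => x Px'; apply: PA => i j; rewrite ord1; exact: Px'.
Qed.

Lemma fun_continuousV (Y : topologicalType) (f : Y -> R) :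
  (forall y, f y != 0) -> continuous f -> continuous (fun y => (f y)^-1).
Proof. by move=> f0 cf y; apply: cvgV => //; exact: cf. Qed.

Lemma fun_continuous_sum (Y : topologicalType) (I : Type) (r : seq I) (f : I -> Y -> R) :
  (forall i, continuous (f i)) -> continuous (fun y => \sum_(i <- r) f i y).
Proof.
move=> cf; elim: r => [|i r IHr].
  apply: (@fun_continuous_ext _ _ (fun=> 0)) => [y|]; first by rewrite big_nil.
  by continuity.
apply: (@fun_continuous_ext _ _ (fun y => f i y + \sum_(i <- r) f i y)).
  by move=> y; rewrite big_cons.
by have := cf i => ?; continuity.
Qed.

(** The straight-line homotopy from [u] to [v] in the plane, followed by [H]. *)
Lemma plane_homotopic (b : T) (f g : loop R b) (H : R * R -> T)
    (u v : R -> R * R) :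
  continuous H -> continuous u -> continuous v -> u 0 = v 0 -> u 1 = v 1 ->
  (forall t, `[0, 1]%classic t -> f t = H (u t)) ->
  (forall t, `[0, 1]%classic t -> g t = H (v t)) -> homotopic f g.
Proof.
move=> cH cu cv e0 e1 fH gH.
have c1 (w : R -> R * R) : continuous w -> continuous (fun z : R * R => (w z.2).1).
  move=> cw; apply: (@continuous_compT _ _ _ (fun z : R * R => w z.2) fst); last by continuity.
  by apply: (@continuous_compT _ _ _ snd w); continuity.
have c2 (w : R -> R * R) : continuous w -> continuous (fun z : R * R => (w z.2).2).
  move=> cw; apply: (@continuous_compT _ _ _ (fun z : R * R => w z.2) snd); last by continuity.
  by apply: (@continuous_compT _ _ _ snd w); continuity.
apply: (@homotopicI _ _ _ _ _ (fun s t =>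
  H ((u t).1 + s * ((v t).1 - (u t).1), (u t).2 + s * ((v t).2 - (u t).2)))).
- apply: continuous_compT cH.
  by have := (c1 u cu, c2 u cu, c1 v cv, c2 v cv) => -[[[? ?] ?] ?]; continuity.
- by move=> t It; rewrite !mul0r !addr0 fH //; case: (u t).
- by move=> t It; rewrite !mul1r !(addrC (_ (u t))) !subrK gH //; case: (v t).
- move=> s _; rewrite e0 !subrr !mulr0 !addr0 -(loop0 g) gH; last exact: unit0.
  by case: (v 0).
- move=> s _; rewrite e1 !subrr !mulr0 !addr0 -(loop1 g) gH; last exact: unit1.
  by case: (v 1).
Qed.

End PlaneHomotopies.

(** * Parametrized edges and triangles *)

Section SimplexParametrization.
Variable R : realType.

(* A retraction of the hyperplane of barycentric coordinates onto the simplex;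
   its denominator is at least 1 there. *)
Definition normal_pos n (u : 'I_n.+1 -> R) : 'rV[R]_n.+1 :=
  \row_i (Num.max 0 (u i) / \sum_j Num.max 0 (u j)).

Lemma sum_pos_ge1 n (u : 'I_n.+1 -> R) :
  \sum_i u i = 1 -> 1 <= \sum_j Num.max 0 (u j).
Proof. by move=> <-; apply: ler_sum => i _; rewrite le_max lexx orbT. Qed.

Lemma normal_pos_simplex n (u : 'I_n.+1 -> R) :
  \sum_i u i = 1 -> std_simplex (normal_pos u).
Proof.
move=> /sum_pos_ge1 u1; have u0 := lt_le_trans ltr01 u1.
split=> [i|]; first by rewrite mxE divr_ge0 ?(ltW u0) // le_max lexx.
under eq_bigr do rewrite mxE.
by rewrite -mulr_suml mulfV // gt_eqF.
Qed.

(** Only the positive parts matter, up to a common scale; this identifies points at which the pieces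
    of [triangle_fun] meet. *)
Lemma normal_posZ n (u v : 'I_n.+1 -> R) (k : R) : 0 < k ->
  (forall i, Num.max 0 (u i) = k * Num.max 0 (v i)) ->
  normal_pos u = normal_pos v.
Proof.
move=> k0 uv; apply/rowP => i; rewrite !mxE.
under eq_bigr do rewrite uv.
by rewrite -mulr_sumr uv -mulf_div mulfV ?mul1r // gt_eqF.
Qed.

Lemma normal_pos_continuous (Y : topologicalType) n (u : Y -> 'I_n.+1 -> R) :
  (forall y, \sum_i u y i = 1) -> (forall i, continuous (fun y => u y i)) ->
  continuous (fun y => normal_pos (u y)).
Proof.
move=> u1 cu; apply: fun_continuous_row => j.
have cmax i : continuous (fun y => Num.max 0 (u y i)) by have := cu i => ?; continuity.
have csum : continuous (fun y => \sum_i Num.max 0 (u y i)).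
  exact: (@fun_continuous_sum _ _ _ _ (fun i y => Num.max 0 (u y i))).
have cinv : continuous (fun y => (\sum_i Num.max 0 (u y i))^-1).
  apply: fun_continuousV csum => y.
  by rewrite gt_eqF // (lt_le_trans ltr01) // sum_pos_ge1.
apply: (@fun_continuous_ext _ _ (fun y => Num.max 0 (u y j) * (\sum_i Num.max 0 (u y i))^-1)).
  by move=> y; rewrite mxE.
by have := cmax j => ?; continuity.
Qed.

Lemma continuous_std_simplex (Y : topologicalType) n (f : Y -> @std_simplex R n) :
  continuous (fun y => set_val (f y)) -> continuous f.
Proof. by move=> cf; apply: continuous_comp_initial. Qed.

Definition bary1 (t : R) (i : 'I_2) : R := if val i is 0 then 1 - t else t.

Definition bary2 (z : R * R) (i : 'I_3) : R :=
  match val i with 0 => 1 - z.1 - z.2 | 1 => z.1 | _ => z.2 end.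

Lemma sum_bary1 t : \sum_i bary1 t i = 1.
Proof. by rewrite !big_ord_recl big_ord0 /bary1 /=; lra. Qed.

Lemma sum_bary2 z : \sum_i bary2 z i = 1.
Proof. by rewrite !big_ord_recl big_ord0 /bary2 /=; lra. Qed.

Definition edge (t : R) : @std_simplex R 1 :=
  SigSub (mem_set (normal_pos_simplex (sum_bary1 t))).

Definition triangle (z : R * R) : @std_simplex R 2 :=
  SigSub (mem_set (normal_pos_simplex (sum_bary2 z))).

Lemma edge_continuous : continuous edge.
Proof.
apply: continuous_std_simplex; apply: (normal_pos_continuous sum_bary1).
by case=> -[|i] ilt; rewrite /bary1 /=; continuity.
Qed.

Lemma triangle_continuous : continuous triangle.
Proof.
apply: continuous_std_simplex; apply: (normal_pos_continuous sum_bary2).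
by case=> -[|[|i]] ilt; rewrite /bary2 /=; continuity.
Qed.

Lemma triangle_scale (z w : R * R) (k : R) : 0 < k ->
  (forall i, Num.max 0 (bary2 z i) = k * Num.max 0 (bary2 w i)) ->
  triangle z = triangle w.
Proof. by move=> k0 zw; apply: val_inj => /=; exact: normal_posZ zw. Qed.

Lemma coface_edge (i : 'I_3) t (z : R * R) :
  (forall j, bary2 z j = if unlift i j is Some k then bary1 t k else 0) ->
  coface i (edge t) = triangle z.
Proof.
move=> zt; apply: val_inj; apply/rowP => j /=; rewrite !mxE.
have -> : \sum_j Num.max 0 (bary2 z j) = \sum_j Num.max 0 (bary1 t j).
  rewrite (bigD1_ord i) //= zt unlift_none maxxx add0r.
  by apply: eq_bigr => k _; rewrite zt liftK.
by rewrite zt; case: unliftP => [k|] _; rewrite ?mxE // maxxx mul0r.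
Qed.

Lemma coface2_edge t : coface (inord 2) (edge t) = triangle (t, 0).
Proof.
apply: coface_edge => j; case: unliftP => [k|] ->; last by rewrite /bary2 inordE.
by rewrite /bary2 /bary1 /= inordE; case: k => -[|[|]] //= _; lra.
Qed.

Lemma coface1_edge t : coface (inord 1) (edge t) = triangle (0, t).
Proof.
apply: coface_edge => j; case: unliftP => [k|] ->; last by rewrite /bary2 inordE.
by rewrite /bary2 /bary1 /= inordE; case: k => -[|[|]] //= _; lra.
Qed.

Lemma coface0_edge t : coface ord0 (edge t) = triangle (1 - t, t).
Proof.
apply: coface_edge => j; case: unliftP => [k|] ->; last by rewrite /bary2 /=; lra.
by rewrite /bary2 /bary1 /=; case: k => -[|[|]] //= _; lra.
Qed.

End SimplexParametrization.

(** * Edge loops and the relation given by a 2-simplex *)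

Section Whiskers.
Variables (R : realType) (X : topologicalType) (x0 : X).

(* Paths are parametrized by the whole line and constant outside [0, 1]. *)
Definition joins (w : R -> X) (x y : X) : Prop :=
  [/\ continuous w, forall t, t <= 0 -> w t = x & forall t, 1 <= t -> w t = y].

Variable w : X -> R -> X.
Hypothesis wP : forall x, joins (w x) x0 x.

Lemma w_continuous x (Y : topologicalType) (f : Y -> R) :
  continuous f -> continuous (fun y => w x (f y)).
Proof. by move=> cf; have [cw _ _] := wP x; exact: continuous_compT cf cw. Qed.

Lemma w_le0 x t : t <= 0 -> w x t = x0. Proof. by have [_ + _] := wP x; apply. Qed.
Lemma w_ge1 x t : 1 <= t -> w x t = x. Proof. by have [_ _ +] := wP x; apply. Qed.

(** The first and last quarters run along the paths to the end points, the middle half along the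
    edge. The tests have the form required by [glue_continuous], and the timing matches the sides of
    the large triangle used for 2-simplices. *)
Definition edge_fun (s : continuousType (@std_simplex R 1) X) (t : R) : X :=
  if 1 - 4 * t <= 0 then
    if 4 * t - 3 <= 0 then s (edge ((4 * t - 1) / 2)) else w (s (edge 1)) (4 - 4 * t)
  else w (s (edge 0)) (4 * t).

Lemma simplex_continuous n (s : continuousType (@std_simplex R n) X) : continuous s.
Proof. exact: cts_fun. Qed.

Lemma edge_fun_continuous s : continuous (edge_fun s).
Proof.
apply: (@glue_continuous _ _ _ (fun t : R => 1 - 4 * t)
  (fun t => if 4 * t - 3 <= 0 then s (edge ((4 * t - 1) / 2)) else w (s (edge 1)) (4 - 4 * t))
  (fun t => w (s (edge 0)) (4 * t))).
- by continuity.
- apply: (@glue_continuous _ _ _ (fun t : R => 4 * t - 3)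
    (fun t => s (edge ((4 * t - 1) / 2))) (fun t => w (s (edge 1)) (4 - 4 * t))).
  + by continuity.
  + apply: continuous_compT (@simplex_continuous _ s).
    by apply: continuous_compT (@edge_continuous R); continuity.
  + by apply: w_continuous; continuity.
  + move=> t t0; rewrite (_ : (4 * t - 1) / 2 = 1); last by lra.
    by rewrite w_ge1 //; lra.
- have c4 : continuous (fun t : R => 4 * t) by continuity.
  refine (@w_continuous _ R (fun t : R => 4 * t) c4).
- move=> t t0; rewrite ifT; last by lra.
  rewrite (_ : (4 * t - 1) / 2 = 0); last by lra.
  by rewrite w_ge1 //; lra.
Qed.

Lemma edge_is_loop s : is_loop x0 (edge_fun s).
Proof.
split; first exact/continuous_subspaceT/edge_fun_continuous.
- by rewrite /edge_fun ifF ?w_le0 //; try lra; apply/negbTE; lra.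
- rewrite /edge_fun ifT; last by lra.
  by rewrite ifF ?w_le0 //; try lra; apply/negbTE; lra.
Qed.

Definition edge_loop s : loop R x0 := Loop (edge_is_loop s).

Section TwoSimplex.
Variable s : continuousType (@std_simplex R 2) X.

(* The plane of barycentric coordinates is cut into the triangle, retracted by
   [triangle], and the three corner regions where two coordinates are negative;
   there [whisker] is the distance travelled along the path from the vertex back
   to [x0].  The corners (-1, -1), (3, -1), (-1, 3) of the large triangle are
   sent to [x0], and its sides to the loops of the three faces. *)
Definition whisker0 (z : R * R) : R := Num.min (- z.1) (- z.2).
Definition whisker1 (z : R * R) : R := Num.min (z.1 + z.2 - 1) (- z.2).
Definition whisker2 (z : R * R) : R := Num.min (z.1 + z.2 - 1) (- z.1).

Definition triangle_fun (z : R * R) : X :=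
  if whisker0 z <= 0 then
    if whisker1 z <= 0 then
      if whisker2 z <= 0 then s (triangle z)
      else w (s (triangle (0, 1))) (1 - whisker2 z)
    else w (s (triangle (1, 0))) (1 - whisker1 z)
  else w (s (triangle (0, 0))) (1 - whisker0 z).

Lemma triangle_fun_continuous : continuous triangle_fun.
Proof.
apply: (@glue_continuous _ _ _ whisker0 (fun z =>
  if whisker1 z <= 0 then
    if whisker2 z <= 0 then s (triangle z)
    else w (s (triangle (0, 1))) (1 - whisker2 z)
  else w (s (triangle (1, 0))) (1 - whisker1 z))
  (fun z => w (s (triangle (0, 0))) (1 - whisker0 z))).
- by rewrite /whisker0; continuity.
- apply: (@glue_continuous _ _ _ whisker1 (fun z =>
    if whisker2 z <= 0 then s (triangle z)
    else w (s (triangle (0, 1))) (1 - whisker2 z))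
    (fun z => w (s (triangle (1, 0))) (1 - whisker1 z))).
  + by rewrite /whisker1; continuity.
  + apply: (@glue_continuous _ _ _ whisker2 (fun z => s (triangle z))
      (fun z => w (s (triangle (0, 1))) (1 - whisker2 z))).
    * by rewrite /whisker2; continuity.
    * apply: continuous_compT (@simplex_continuous _ s); exact: triangle_continuous.
    * by apply: w_continuous; rewrite /whisker2; continuity.
    (* Where [whisker2] vanishes, the larger of the other two barycentric coordinates is 0, so the
       retraction gives the vertex. The other two corners are similar. *)
    * move=> [b c] z0; rewrite w_ge1 ?z0 ?subr0 //; congr (s _).
      move: z0; rewrite /whisker2 /= => z0.
      apply: (@triangle_scale _ _ _ c); first by move: z0; case_max; lra.
      by case=> -[|[|[|]]] //= ?; rewrite /bary2 /=; move: z0; case_max; lra.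
  + by apply: w_continuous; rewrite /whisker1; continuity.
  + move=> [b c] z0; rewrite ifT; last first.
      by move: z0; rewrite /whisker1 /whisker2 /=; case_max; lra.
    rewrite w_ge1 ?z0 ?subr0 //.
    congr (s _); move: z0; rewrite /whisker1 /= => z0.
    apply: (@triangle_scale _ _ _ b); first by move: z0; case_max; lra.
    by case=> -[|[|[|]]] //= ?; rewrite /bary2 /=; move: z0; case_max; lra.
- by apply: w_continuous; rewrite /whisker0; continuity.
- move=> [b c] z0; rewrite ifT; last first.
    by move: z0; rewrite /whisker1 /whisker0 /=; case_max; lra.
  rewrite ifT; last by move: z0; rewrite /whisker2 /whisker0 /=; case_max; lra.
  rewrite w_ge1 ?z0 ?subr0 //.
  congr (s _); move: z0; rewrite /whisker0 /= => z0.
  apply: (@triangle_scale _ _ _ (1 - b - c)); first by move: z0; case_max; lra.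
  by case=> -[|[|[|]]] //= ?; rewrite /bary2 /=; move: z0; case_max; lra.
Qed.

Let d (i : 'I_3) := singular_face i s.

Lemma triangle_fun01 t : 0 <= t <= 1 ->
  triangle_fun (4 * t - 1, -1) = edge_fun (d (inord 2)) t.
Proof.
move=> /andP[t0 t1]; rewrite /edge_fun /= !coface2_edge /triangle_fun.
have -> : whisker0 (4 * t - 1, -1) = 1 - 4 * t.
  by rewrite /whisker0 /=; case_max; lra.
case: ifP => _; last by congr (w _ _); lra.
have -> : (whisker1 (4 * t - 1, -1) <= 0) = (4 * t - 3 <= 0).
  by apply/idP/idP; rewrite /whisker1 /=; case_max; lra.
case: ifP => t3; last by congr (w _ _); move: t3; rewrite /whisker1 /=; case_max; lra.
rewrite ifT; last by rewrite /whisker2 /=; case_max; lra.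
(* The third barycentric coordinate is -1 on this side, so the two nonnegative ones add up to 2. *)
congr (s _); apply: (@triangle_scale _ _ _ 2) => //.
by case=> -[|[|[|]]] //= ?; rewrite /bary2 /=; case_max; lra.
Qed.

Lemma triangle_fun02 t : 0 <= t <= 1 ->
  triangle_fun (-1, 4 * t - 1) = edge_fun (d (inord 1)) t.
Proof.
move=> /andP[t0 t1]; rewrite /edge_fun /= !coface1_edge /triangle_fun.
have -> : whisker0 (-1, 4 * t - 1) = 1 - 4 * t.
  by rewrite /whisker0 /=; case_max; lra.
case: ifP => _; last by congr (w _ _); lra.
rewrite ifT; last by rewrite /whisker1 /=; case_max; lra.
have -> : (whisker2 (-1, 4 * t - 1) <= 0) = (4 * t - 3 <= 0).
  by apply/idP/idP; rewrite /whisker2 /=; case_max; lra.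
case: ifP => t3; last by congr (w _ _); move: t3; rewrite /whisker2 /=; case_max; lra.
congr (s _); apply: (@triangle_scale _ _ _ 2) => //.
by case=> -[|[|[|]]] //= ?; rewrite /bary2 /=; case_max; lra.
Qed.

Lemma triangle_fun12 t : 0 <= t <= 1 ->
  triangle_fun (3 - 4 * t, 4 * t - 1) = edge_fun (d ord0) t.
Proof.
move=> /andP[t0 t1]; rewrite /edge_fun /= !coface0_edge /triangle_fun.
rewrite ifT; last by rewrite /whisker0 /=; case_max; lra.
have -> : whisker1 (3 - 4 * t, 4 * t - 1) = 1 - 4 * t.
  by rewrite /whisker1 /=; case_max; lra.
rewrite subr0 subrr.
case: ifP => _; last by congr (w _ _); lra.
have -> : (whisker2 (3 - 4 * t, 4 * t - 1) <= 0) = (4 * t - 3 <= 0).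
  by apply/idP/idP; rewrite /whisker2 /=; case_max; lra.
case: ifP => t3; last by congr (w _ _); move: t3; rewrite /whisker2 /=; case_max; lra.
congr (s _); apply: (@triangle_scale _ _ _ 2) => //.
by case=> -[|[|[|]]] //= ?; rewrite /bary2 /=; case_max; lra.
Qed.

(** In the plane, two sides of the large triangle in turn are homotopic to the third, and
    [triangle_fun] carries this homotopy to [X]. *)
Lemma edge_loop_mul :
  (loop_class (edge_loop (d (inord 2))) * loop_class (edge_loop (d ord0)))%g =
  loop_class (edge_loop (d (inord 1))).
Proof.
rewrite -[LHS]/(pi1_mul _ _) pi1_mulE; apply/loop_classP.
apply: (@plane_homotopic _ _ _ _ _ triangle_fun
  (* Two sides at double speed in one formula: the path turns at the corner (3, -1) when t = 1/2. *)
  (fun t => (Num.min (8 * t - 1) (7 - 8 * t), Num.max (-1) (8 * t - 5)))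
  (fun t => (-1, 4 * t - 1))).
- exact: triangle_fun_continuous.
- by continuity.
- by continuity.
- by congr pair; case_max; lra.
- by congr pair; case_max; lra.
- move=> t; rewrite /= in_itv /= => /andP[t0 t1]; rewrite /concat.
  case: ifP => t2; rewrite -?triangle_fun01 -?triangle_fun12; try (by apply/andP; split; lra).
    by congr triangle_fun; congr pair; case_max; lra.
  by congr triangle_fun; congr pair; case_max; lra.
- by move=> t; rewrite /= in_itv /= => t01; rewrite triangle_fun02.
Qed.

End TwoSimplex.
End Whiskers.

(** * Loops as singular cycles *)

Section LoopSimplex.
Variables (R : realType) (X : topologicalType) (x0 : X).

Definition loop_simplex (l : loop R x0) (u : @std_simplex R 1) : X :=
  l (clamp (set_val u 0 ord_max)).

Lemma loop_simplex_continuous l : continuous (loop_simplex l).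
Proof.
apply: (@continuous_compT _ _ _ (fun u : @std_simplex R 1 => set_val u 0 ord_max)
  (fun t => l (clamp t))); last exact: loop_continuous.
apply: (@continuous_compT _ _ _ set_val (fun v : 'rV[R]_2 => v 0 ord_max)).
  exact: initial_continuous.
exact: coord_continuous.
Qed.

HB.instance Definition _ l := isContinuous.Build _ _ (loop_simplex l)
  (@loop_simplex_continuous l).

Definition simplex_of_loop l : singular R X 1 := loop_simplex l.

Lemma set_val_edge t : set_val (edge t) 0 ord_max = clamp t :> R.
Proof.
rewrite /= mxE !big_ord_recl big_ord0 /bary1 /= addr0.
case_max; try lra.
- by rewrite subrK divr1.
- by rewrite add0r divff // gt_eqF.
Qed.

Lemma loop_simplex_edge l t : loop_simplex l (edge t) = l (clamp t).
Proof. by rewrite /loop_simplex set_val_edge clamp_id. Qed.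

(** The path attached to [x0] being constant, the edge loop merely waits, runs through [l] and waits
    again. *)
Lemma edge_loop_homotopic (w : X -> R -> X) (wP : forall x, joins (w x) x0 x) l :
  w x0 = cst x0 -> homotopic (edge_loop wP (simplex_of_loop l)) l.
Proof.
move=> wx0; apply: (@reparam_homotopic _ _ _ l _ _
  (fun t => clamp ((4 * t - 1) / 2)) id).
- by apply: continuous_compT (@clamp_continuous R); continuity.
- by continuity.
- by case_max; lra.
- by case_max; lra.
- move=> t _; rewrite /= /edge_fun /= !loop_simplex_edge.
  rewrite clamp0 clamp1 loop0 loop1 wx0 clamp_id /cst.
  case: ifP => t1; last by rewrite (_ : clamp _ = 0) ?loop0 //; move: t1; case_max; lra.
  case: ifP => t2 //; rewrite (_ : clamp _ = 1) ?loop1 //.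
  by move: t1 t2; case_max; lra.
- by move=> t t01; rewrite clampE.
Qed.

Lemma simplex_of_loop_cycle (F : fieldType) l :
  @cycles F (singular R X) 1 << simplex_of_loop l >>.
Proof.
rewrite /cycles /= boundaryU !big_ord_recl big_ord0 /= addr0 expr0 scale1r.
rewrite /bump /= expr1 scaleN1r.
suff -> : singular_face ord0 (simplex_of_loop l) =
  singular_face (fintype.lift ord0 ord0) (simplex_of_loop l) by rewrite subrr.
apply/continuousEP => u /=; rewrite /loop_simplex /= !mxE.
case: unliftP => [k _|/(congr1 val)] //=.
have -> : k = ord0 by rewrite ord1. 
have [_] := set_valP u; rewrite big_ord1 => ->.
case: unliftP => [k' /(congr1 val)/=|_]; first by rewrite ord1.
by rewrite clamp0 clamp1 loop0 loop1.
Qed.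

End LoopSimplex.

(** Edge loops turn each [theta j] into a singular 1-cochain, a cocycle by [edge_loop_mul]. A
    relation modulo boundaries among the loops therefore gives one among the rows of the matrix. *)
Lemma betti1_lower_bound (R : realType) (F : fieldType) (X : topologicalType)
    (x0 : X) (k m : nat) (theta : 'I_k -> fundamental_group R x0 -> F)
    (l : 'I_m -> loop R x0) :
  (forall x, exists w : R -> X, joins w x0 x) ->
  (forall j x y, theta j (x * y)%g = theta j x + theta j y) ->
  row_free (\matrix_(i, j) theta j (loop_class (l i))) ->
  (m%:R%:E <= betti R F X 1)%E.
Proof.
move=> Xpath thetaM free.
have /choice[w wP] x : exists w : R -> X, joins w x0 x /\ (x = x0 -> w = cst x0).
  have [->|xx0] := pselect (x = x0); last by have [w] := Xpath x; exists w.
  by exists (cst x0); split=> //; split=> //; exact: fun_continuous_cst.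
have wJ x : joins (w x) x0 x by have [] := wP x.
have wx0 : w x0 = cst x0 by have [_ ->] := wP x0.
pose phi j (s : singular R X 1) : F^o := theta j (loop_class (edge_loop wJ s)).
have phi_boundary j (c : chain F (singular R X) 2) : fglift (phi j) (boundary c) = 0.
  apply: (@chain_ext F _ _ F^o (fglift (phi j) \o @boundary F _ 1) \0) => s /=.
  rewrite boundaryU linear_sum !big_ord_recl big_ord0 /= addr0 !linearZ /= !liftU1.
  rewrite /bump /= expr0 expr1 sqrrN expr1n scale1r scaleN1r scale1r.
  have e1 : fintype.lift ord0 ord0 = inord 1 :> 'I_3 by apply/val_inj; rewrite /= inordE.
  have e2 : fintype.lift ord0 (fintype.lift ord0 ord0) = inord 2 :> 'I_3 by apply/val_inj; rewrite /= inordE.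
  rewrite e1 e2 /phi -(edge_loop_mul wJ s) thetaM.
  by rewrite -[RHS]/(0 : F); ring.
apply: ereal_sup_ubound; exists m => //.
exists (fun i => << simplex_of_loop (l i) >>); split=> [i|a [c _ bc] i].
  exact: simplex_of_loop_cycle.
have : \row_i a i = 0.
  apply: (row_free_inj free); rewrite mul0mx; apply/rowP => j; rewrite !mxE.
  rewrite -[RHS](phi_boundary j c) bc linear_sum; apply: eq_bigr => i' _.
  rewrite linearZ /= liftU1 !mxE /phi; congr (_ * theta j _).
  by apply/loop_classP/homotopic_sym; exact: edge_loop_homotopic.
by move=> /rowP/(_ i); rewrite !mxE.
Qed.

(** * Lifting and monodromy *)

Section Lifting.
Variables (X B : topologicalType) (q : X -> B).
Hypothesis qcov : covering_map q.

(** The coincidence set is open, by injectivity on a sheet. It is closed: sheets being disjoint,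
    agreement close to [y] would put [f y] and [g y] in one sheet and make them equal. *)
Lemma unique_lift (Y : topologicalType) (f g : Y -> X) y0 :
  connected [set: Y] -> continuous f -> continuous g ->
  (forall y, q (f y) = q (g y)) -> f y0 = g y0 -> f =1 g.
Proof.
move=> cY cf cg qfg fg0; have [_ _ qev] := qcov.
have nbr (h : Y -> X) y (V : set X) : continuous h -> open V -> V (h y) ->
    \forall y' \near y, V (h y').
  by move=> ch oV Vy; apply: ch; exact: open_nbhs_nbhs.
suff E : [set y | f y = g y] = setT by move=> y; have : setT y by []; rewrite -E.
apply: cY; first by exists y0.
- exists [set y | f y = g y]; last by rewrite setTI.
  rewrite openE => y /= fgy.
  have [U Uy [sheets [oU qU _ shP]]] := qev (q (f y)).
  have : (q @^-1` U) (f y) by [].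
  rewrite qU => -[V sV Vf]; have [oV [_ Vinj _] _] := shP V sV.
  have Vg : V (g y) by rewrite -fgy.
  near=> y'; apply: Vinj; rewrite ?inE //.
  + by near: y'; exact: nbr.
  + by near: y'; exact: nbr.
- exists [set y | f y = g y]; last by rewrite setTI.
  rewrite -openC openE => y /= fgy.
  have [U Uy [sheets [oU qU tr shP]]] := qev (q (f y)).
  have : (q @^-1` U) (f y) by [].
  have : (q @^-1` U) (g y) by rewrite /= -qfg.
  rewrite qU => -[V' sV' Vg] [V sV Vf].
  have [oV [_ Vinj _] _] := shP V sV; have [oV' _ _] := shP V' sV'.
  near=> y' => /= fgy'.
  have Vy' : V (f y') by near: y'; exact: nbr.
  have Vy'' : V' (f y') by rewrite fgy'; near: y'; exact: nbr.
  have VV' : V = V' by apply: tr => //; exists (f y').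
  by apply: fgy; apply: Vinj; rewrite ?inE // VV'.
Unshelve. all: by end_near. Qed.

(** The lift is the inverse of [q] on the sheet, continuous because [q] is open there. *)
Lemma lift_in_sheet (Y : topologicalType) (h : Y -> B) (U : set B) (V : set X) :
  set_bij V U q -> (forall W, open W -> W `<=` V -> open (q @` W)) -> open V ->
  continuous h -> (forall y, U (h y)) ->
  exists L : Y -> X,
    [/\ continuous L, forall y, V (L y) & forall y, q (L y) = h y].
Proof.
move=> [_ Vinj Vsurj] Vop oV ch Uh.
have /choice[L LP] y : exists v, V v /\ q v = h y.
  by have [v Vv vh] := Vsurj _ (Uh y); exists v.
have LV y : V (L y) by have [] := LP y.
have qL y : q (L y) = h y by have [] := LP y.
exists L; split=> // y A; rewrite nbhsE => -[W [oW Wy] WA].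
have oq : open (q @` (W `&` V)) by apply: Vop; [exact: openI|exact: subIsetr].
have : nbhs y (h @^-1` (q @` (W `&` V))).
  by apply: ch; apply: open_nbhs_nbhs; split=> //; exists (L y).
apply: filterS => y' [v [Wv Vv] vh]; apply: WA.
by rewrite (Vinj (L y') v) ?inE // qL.
Qed.

Lemma lift_evenly_covered (Y : topologicalType) (h : Y -> B) (U : set B) y0 x :
  evenly_covered q U -> continuous h -> (forall y, U (h y)) -> q x = h y0 ->
  exists L : Y -> X, [/\ continuous L, L y0 = x & forall y, q (L y) = h y].
Proof.
move=> [sheets [oU qU _ shP]] ch Uh qx.
have : (q @^-1` U) x by rewrite /= qx.
rewrite qU => -[V sV Vx]; have [oV Vbij Vop] := shP V sV.
have [L [cL LV qL]] := lift_in_sheet Vbij Vop oV ch Uh.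
exists L; split=> //; have [_ Vinj _] := Vbij.
by apply: Vinj; rewrite ?inE // qL.
Qed.

End Lifting.

(** * Lifting of squares and paths *)

Section IntervalInduction.
Variable R : realType.

(** Plays the part of a Lebesgue number: the supremum of the [t] with [P a t] cannot stop before
    [b], since a small interval around it goes further. *)
Lemma segment_induction (P : R -> R -> Prop) :
  (forall a b c, a <= b -> b <= c -> P a b -> P b c -> P a c) ->
  (forall x, exists2 e, 0 < e &
     forall a b, x - e < a -> a <= b -> b < x + e -> P a b) ->
  forall a b, a <= b -> P a b.
Proof.
move=> Pcat Ploc a b ab.
pose S := [set t | a <= t <= b /\ P a t].
have Sa : S a.
  split; first by rewrite lexx.
  by have [e e0 Pe] := Ploc a; apply: Pe; lra.
have Sub : has_ubound S by exists b => t [/andP[]].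
have Ssup : has_sup S by split=> //; exists a.
have sa : a <= sup S by exact: ub_le_sup.
have sb : sup S <= b by apply: ge_sup => [|t [/andP[]//]]; exists a.
have [e e0 Pe] := Ploc (sup S).
have [t [/andP[at_ tb] Pat] ts] := sup_adherent e0 Ssup.
pose c := Num.min b (sup S + e / 2).
have t_sup : t <= sup S by apply: ub_le_sup => //; split=> //; apply/andP.
have ce : c < sup S + e by rewrite /c gt_min; apply/orP; right; lra.
have tc : t <= c by rewrite /c le_min tb /=; lra.
have Pac : P a c by apply: (Pcat _ t) => //; exact: Pe.
have : c <= sup S.
  apply: ub_le_sup => //; split=> //; rewrite (le_trans at_ tc) /=.
  by rewrite /c ge_min lexx.
rewrite {1}/c ge_min => /orP[bs|]; last by lra.
by have -> : b = c by rewrite /c min_l //; lra.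
Qed.

End IntervalInduction.

Lemma connected_real (R : realType) : connected [set: R].
Proof. by apply/connected_intervalP => x y _ _ z _. Qed.

Section SquareLifting.
Variables (R : realType) (X B : topologicalType) (q : X -> B).
Hypothesis qcov : covering_map q.

Definition truncate (a b t : R) : R := Num.max a (Num.min t b).

Lemma truncate_id a b t : a <= t <= b -> truncate a b t = t.
Proof. by move=> /andP[at_ tb]; rewrite /truncate min_l // max_r. Qed.

Lemma truncate_bounds a b t : a <= b -> a <= truncate a b t <= b.
Proof. by move=> ab; rewrite /truncate; case_max; lra. Qed.

Lemma truncate_continuous a b (Y : topologicalType) (f : Y -> R) :
  continuous f -> continuous (fun y => truncate a b (f y)).
Proof. by move=> cf; rewrite /truncate; continuity. Qed.

Variable H : R * R -> B.
Hypothesis cH : continuous H.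

(** Truncation extends the lift over a rectangle to a continuous map on the whole plane; allowing
    any [x] above the corner makes concatenation possible. *)
Definition liftable (a b c d : R) : Prop := forall x, q x = H (a, c) ->
  exists L : R * R -> X, [/\ continuous L, L (a, c) = x &
    forall z, q (L z) = H (truncate a b z.1, truncate c d z.2)].

Lemma line_lift_eq (L L' : R * R -> X) (u : R -> R * R) t0 :
  continuous L -> continuous L' -> continuous u ->
  (forall t, q (L (u t)) = q (L' (u t))) -> L (u t0) = L' (u t0) ->
  forall t, L (u t) = L' (u t).
Proof.
move=> cL cL' cu qLL' e; apply: (unique_lift qcov (@connected_real R)) e => //.
  exact: continuous_compT cu cL.
exact: continuous_compT cu cL'.
Qed.

(** The second lift starts at the value of the first at [(b, c)]; uniqueness along the common line
    makes the two agree there. *)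
Lemma liftable_cat1 a b e c d : a <= b -> b <= e -> c <= d ->
  liftable a b c d -> liftable b e c d -> liftable a e c d.
Proof.
move=> ab be cd l1 l2 x qx; have [L [cL Lx qL]] := l1 x qx.
have [|L' [cL' L'x qL']] := l2 (L (b, c)).
  by rewrite qL /= !truncate_id ?lexx ?cd ?ab.
have LL' t : L (b, t) = L' (b, t).
  apply: (@line_lift_eq L L' (fun t => (b, t)) c) => //; first by continuity.
  by move=> t'; rewrite qL qL' /= !(@truncate_id _ _ b) ?lexx ?ab ?be.
exists (fun z => if z.1 - b <= 0 then L z else L' z); split.
- apply: (@glue_continuous _ _ _ (fun z : R * R => z.1 - b)) => //.
    by continuity.
  by move=> [z1 z2] /= z0; rewrite (_ : z1 = b) //; lra.
- by rewrite /= ifT ?Lx //; lra.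
- move=> [z1 z2] /=; case: ifP => zb; rewrite ?qL ?qL' /=.
    by congr (H (_, _)); rewrite /truncate; move: zb; case_max; lra.
  by congr (H (_, _)); rewrite /truncate; move: zb; case_max; lra.
Qed.

Lemma liftable_cat2 a b c d e : a <= b -> c <= d -> d <= e ->
  liftable a b c d -> liftable a b d e -> liftable a b c e.
Proof.
move=> ab cd de l1 l2 x qx; have [L [cL Lx qL]] := l1 x qx.
have [|L' [cL' L'x qL']] := l2 (L (a, d)).
  by rewrite qL /= !truncate_id ?lexx ?cd ?ab.
have LL' t : L (t, d) = L' (t, d).
  apply: (@line_lift_eq L L' (fun t => (t, d)) a) => //; first by continuity.
  by move=> t'; rewrite qL qL' /= !(@truncate_id _ _ d) ?lexx ?cd ?de.
exists (fun z => if z.2 - d <= 0 then L z else L' z); split.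
- apply: (@glue_continuous _ _ _ (fun z : R * R => z.2 - d)) => //.
    by continuity.
  by move=> [z1 z2] /= z0; rewrite (_ : z2 = d) //; lra.
- by rewrite /= ifT ?Lx //; lra.
- move=> [z1 z2] /=; case: ifP => zb; rewrite ?qL ?qL' /=.
    by congr (H (_, _)); rewrite /truncate; move: zb; case_max; lra.
  by congr (H (_, _)); rewrite /truncate; move: zb; case_max; lra.
Qed.

Lemma liftable_local x y : exists2 e, 0 < e & forall a b c d,
  x - e < a -> a <= b -> b < x + e -> y - e < c -> c <= d -> d < y + e ->
  liftable a b c d.
Proof.
have [_ _ /(_ (H (x, y)))[U Uxy Uev]] := qcov.
have [sheets [oU _ _ _]] := Uev.
have : nbhs (x, y) (H @^-1` U) by apply: cH; exact: open_nbhs_nbhs.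
move=> /nbhs_ballP[e /= e0 He]; exists e => // a b c d xa ab bx yc cd dy x' qx'.
have [|z||L [cL Lx qL]] := @lift_evenly_covered _ _ q (R * R)%type
  (fun z => H (truncate a b z.1, truncate c d z.2)) U (a, c) x' Uev.
- apply: continuous_compT cH; apply: fun_continuous_pair.
    by apply: truncate_continuous; continuity.
  by apply: truncate_continuous; continuity.
- have /andP[? ?] := @truncate_bounds a b z.1 ab.
  have /andP[? ?] := @truncate_bounds c d z.2 cd.
  apply: He; split => /=; rewrite /ball /= ltr_norml; apply/andP; split; lra.
- by rewrite /= !truncate_id ?lexx ?ab ?cd.
- by exists L.
Qed.

(** [segment_induction] is applied to the second coordinate, which gives liftable strips of some
    positive width, then to the first. *)
Lemma square_lift x : q x = H (0, 0) ->
  exists L : R * R -> X, [/\ continuous L, L (0, 0) = x &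
    forall z, q (L z) = H (clamp z.1, clamp z.2)].
Proof.
move: x; rewrite -/(liftable 0 1 0 1).
pose P a b c d := a <= b -> c <= d -> liftable a b c d.
have strip x : forall c d, c <= d -> exists2 e, 0 < e & forall a b,
    x - e < a -> a <= b -> b < x + e -> liftable a b c d.
  apply: segment_induction => [c d c' cd dc' [e1 e10 P1] [e2 e20 P2]|y].
    exists (Num.min e1 e2); first by rewrite lt_min e10.
    have [m1 m2] : Num.min e1 e2 <= e1 /\ Num.min e1 e2 <= e2.
      by split; rewrite ge_min lexx ?orbT.
    move=> a b xa ab bx.
    by apply: (@liftable_cat2 _ _ _ d) => //; [apply: P1|apply: P2]; lra.
  have [e e0 Pe] := liftable_local x y; exists e => // c d yc cd dy.
  by exists e => // a b xa ab bx; exact: Pe.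
apply: (@segment_induction _ (fun a b => liftable a b 0 1)) => // [a b c ab bc|x].
  exact: liftable_cat1.
exact: strip.
Qed.

End SquareLifting.

Lemma path_lift (R : realType) (X B : topologicalType) (q : X -> B)
    (f : R -> B) x : covering_map q -> continuous f -> q x = f 0 ->
  exists l : R -> X, [/\ continuous l, l 0 = x & forall t, q (l t) = f (clamp t)].
Proof.
move=> qcov cf qx.
have [||L [cL L0 qL]] := @square_lift R _ _ q qcov (fun z => f z.2) _ x.
- by apply: continuous_compT cf; continuity.
- exact: qx.
- exists (fun t => L (0, t)); split=> //.
  apply: (@continuous_compT _ _ _ (fun t : R => (0 : R, t)) L _ cL).
  by continuity.
Qed.

Section ClampLemmas.
Variable R : realType.

Lemma clamp_le0 (t : R) : t <= 0 -> clamp t = 0.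
Proof. by case_max; lra. Qed.

Lemma clamp_ge1 (t : R) : 1 <= t -> clamp t = 1.
Proof. by case_max; lra. Qed.

Lemma clamp_double (t : R) :
  [/\ (2 * clamp t - 1 <= 0) = (2 * t - 1 <= 0), clamp (2 * clamp t) = clamp (2 * t)
    & clamp (2 * clamp t - 1) = clamp (2 * t - 1)].
Proof.
have [t0|t0] := leP t 0.
  rewrite (clamp_le0 t0) mulr0 !(@clamp_le0 (2 * t)) ?(@clamp_le0 (2 * t - 1))
    ?(@clamp_le0 (_ - 1)) ?clamp0; try lra.
  by split=> //; apply/idP/idP; lra.
have [t1|t1] := leP 1 t.
  rewrite (clamp_ge1 t1) mulr1 !(@clamp_ge1 (2 * t)) ?(@clamp_ge1 (2 * t - 1))
    ?(@clamp_ge1 (_ - 1)) ?(@clamp_ge1 2); try lra.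
  by split=> //; apply/idP/idP; lra.
by rewrite (@clampE _ t) //= in_itv /= !ltW.
Qed.

Lemma joins_clamp (X : topologicalType) (w : R -> X) x y t :
  joins w x y -> w (clamp t) = w t.
Proof.
move=> [_ w0 w1]; have [t0|t0] := leP t 0; first by rewrite clamp_le0 // !w0.
have [t1|t1] := leP 1 t; first by rewrite clamp_ge1 // !w1.
by rewrite clampE //= in_itv /= !ltW.
Qed.

End ClampLemmas.

(** * Monodromy of a regular covering *)

Section Monodromy.
Variables (R : realType) (X B : topologicalType) (q : X -> B) (x0 : X).
Variable G : zmodType.
Hypothesis qreg : regular_covering q G.

Let qcov : covering_map q. Proof. by case: qreg. Qed.
Let q_continuous : continuous q. Proof. by case: qcov. Qed.

Lemma push_is_loop (l : loop R x0) : is_loop (q x0) (q \o l).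
Proof.
split; rewrite /= ?loop0 ?loop1 //.
apply: within_of_continuous (continuous_compT (@loop_continuous _ _ _ l) q_continuous) _.
by move=> t t01; rewrite clampE.
Qed.

Definition push_loop l : loop R (q x0) := Loop (push_is_loop l).

Definition push (g : fundamental_group R x0) : fundamental_group R (q x0) :=
  loop_class (push_loop (repr g)).

Lemma push_homotopic l l' : homotopic l l' -> homotopic (push_loop l) (push_loop l').
Proof.
case/homotopicE=> K [[cK K0 K1 Kl Kr] _].
apply: (@homotopicI _ _ _ _ _ (fun s t => q (K s t))).
- exact: continuous_compT cK q_continuous.
- by move=> t t01; rewrite K0.
- by move=> t t01; rewrite K1.
- by move=> s _; rewrite Kl.
- by move=> s _; rewrite Kr.
Qed.

Lemma pushE l : push (loop_class l) = loop_class (push_loop l).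
Proof. by apply/loop_classP/push_homotopic; exact: repr_homotopic. Qed.

Lemma pushM g h : push (g * h)%g = (push g * push h)%g.
Proof.
have [l ->] := loop_class_surj g; have [l' ->] := loop_class_surj h.
rewrite -[(_ * _)%g]/(pi1_mul _ _) -[RHS]/(pi1_mul _ _) pi1_mulE !pushE pi1_mulE.
apply/loop_classP; apply: (@reparam_homotopic _ _ _ (push_loop (concat_loop l l')) _ _ id id);
  rewrite //; try by continuity.
  by move=> t t01; rewrite clampE.
by move=> t t01; rewrite clampE //= /concat; case: ifP.
Qed.

(** [G] acts simply transitively on the fibre of [x0]: two deck transformations that agree at [x0]
    are lifts of the same map [q], hence equal. *)
Lemma regular_deck_action : exists phi : G -> X -> X,
  [/\ forall a, deck_transformation q (phi a),
      forall y, q y = q x0 -> exists a, y = phi a x0,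
      forall a b, phi a x0 = phi b x0 -> a = b,
      forall a b, phi (a + b) = phi a \o phi b & phi 0 = id].
Proof.
have [Xcon _ qtrans [phi [phi_fun phi_inj phi_surj] phiD]] := qreg.
have phi_deck a : deck_transformation q (phi a) by exact: phi_fun.
exists phi; split=> //.
- move=> y /esym /qtrans[h /phi_surj[a _ <-] <-].
  by exists a.
- move=> a b ab; apply: phi_inj; rewrite ?inE //; apply/funext.
  have [ca qa _] := phi_deck a; have [cb qb _] := phi_deck b.
  apply: (@unique_lift _ _ _ qcov _ _ _ x0) => // y.
  by rewrite -[LHS]/((q \o phi a) y) qa -[RHS]/((q \o phi b) y) qb.
(* [phi 0] is idempotent and invertible. *)
- have [_ _ [g [_ gK _]]] := phi_deck 0.
  apply/funext => y; rewrite -[LHS]gK -[RHS]gK; congr g.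
  by rewrite -[LHS]/((phi 0 \o phi 0) y) -phiD addr0.
Qed.

(** [pi g] is the element that carries [x0] to the end of the lift of [g] starting at [x0].
    Projecting a path from [x0] to [phi a x0] gives surjectivity; a class in the kernel lifts to a
    loop. *)
Lemma exists_monodromy :
  exists pi : fundamental_group R (q x0) -> G,
    [/\ forall g h, pi (g * h)%g = pi g + pi h,
        (forall x, exists w : R -> X, joins w x0 x) -> forall a, exists g, pi g = a,
        forall g, pi (push g) = 0 &
        forall g, pi g = 0 -> exists l, g = loop_class (push_loop l)].
Proof.
have [phi [phi_deck phi_trans phi_inj phiD phi0]] := regular_deck_action.
pose lift_of (f : loop R (q x0)) (l : R -> X) :=
  [/\ continuous l, l 0 = x0 & forall t, q (l t) = f (clamp t)].
have lift_exists f : exists l, lift_of f l.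
  have [||l lP] := @path_lift R X B q (fun t => f (clamp t)) x0 qcov.
  - exact: loop_continuous.
  - by rewrite clamp0 loop0.
  - by exists l; have [cl l0 ql] := lP; split=> // t; rewrite ql clamp_id.
(* The lifted homotopy is constant on the two sides lying over the base point. *)
have lift_homotopic f f' l l' : homotopic f f' -> lift_of f l -> lift_of f' l' ->
    l 1 = l' 1.
  case/homotopicE=> K [[cK K0 K1 Kl Kr] Kc] [cl l0 ql] [cl' l'0 ql'].
  have [||L [cL L00 qL]] := @square_lift R X B q qcov (fun z => K z.1 z.2) _ x0.
  - exact: cK.
  - by rewrite /= Kl.
  have uniq (u : R -> R * R) (l1 : R -> X) : continuous u -> continuous l1 ->
      (forall t, q (L (u t)) = q (l1 t)) -> L (u 0) = l1 0 -> forall t, L (u t) = l1 t.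
    move=> cu cl1 ql1 e; apply: (unique_lift qcov (@connected_real R)) e => //.
    exact: continuous_compT cu cL.
  have L0 t : L (0, t) = l t.
    apply: (uniq (fun t => (0, t))) => [||t'|] //; rewrite ?L00 //; first by continuity.
    by rewrite qL ql clamp0 K0 //; exact: clampI.
  have Lb s : L (s, 0) = x0.
    apply: (uniq (fun s => (s, 0)) (fun=> x0)) => [||s'|] //; [by continuity..|].
    by rewrite qL Kl // clamp0.
  have L1 t : L (1, t) = l' t.
    apply: (uniq (fun t => (1, t))) => [||t'|] //; rewrite ?Lb //; first by continuity.
    by rewrite qL ql' clamp1 K1 //; exact: clampI.
  have Lt s : L (s, 1) = L (0, 1).
    apply: (uniq (fun s => (s, 1)) (fun=> L (0, 1))) => [||s'|] //; [by continuity..|].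
    by rewrite !qL !Kr // clamp1.
  by rewrite -L0 -L1 Lt.
have /choice[pi piP] (g : fundamental_group R (q x0)) :
    exists a, exists2 l, lift_of (repr g) l & l 1 = phi a x0.
  have [l lP] := lift_exists (repr g); have [_ _ ql] := lP.
  by have [|a la] := phi_trans (l 1); [rewrite ql clamp1 loop1|exists a, l].
have piE f l a : lift_of f l -> l 1 = phi a x0 -> pi (loop_class f) = a.
  move=> lf la; have [l' l'f l'a] := piP (loop_class f).
  apply: phi_inj; rewrite -la -l'a.
  exact: lift_homotopic (repr_homotopic f) l'f lf.
have phi_continuous a : continuous (phi a) by have [] := phi_deck a.
have q_phi a y : q (phi a y) = q y.
  by have [_ qa _] := phi_deck a; rewrite -[RHS](congr1 (@^~ y) qa).
exists pi; split.
- move=> g h; have [l1 [cl1 l10 ql1] l11] := piP g; have [l2 [cl2 l20 ql2] l21] := piP h.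
  rewrite -{1}[g]reprK -{1}[h]reprK -[(_ * _)%g]/(pi1_mul _ _) pi1_mulE.
  (* The product lifts to the lift of [g] followed by the translate by [phi (pi g)] of the lift of
     [h]. *)
  apply: (@piE _ (fun t => if 2 * t - 1 <= 0 then l1 (2 * t) else phi (pi g) (l2 (2 * t - 1)))).
    split.
    + apply: (@glue_continuous _ _ _ (fun t : R => 2 * t - 1) (fun t => l1 (2 * t))
        (fun t => phi (pi g) (l2 (2 * t - 1)))).
      * by continuity.
      * have c2 : continuous (fun t : R => 2 * t) by continuity.
        exact: (@continuous_compT _ _ _ _ l1 c2).
      * apply: continuous_compT (phi_continuous _).
        by apply: continuous_compT cl2; continuity.
      * by move=> t t0; rewrite t0 l20 -l11; congr l1; lra.
    + by rewrite ifT ?mulr0 //; lra.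
    + move=> t; rewrite /= concat_clamp; last exact: clampI.
      have [-> -> ->] := clamp_double t.
      by case: ifP => _; rewrite ?q_phi.
  rewrite ifF; last by apply/negbTE; lra.
  by rewrite phiD /= -l21; congr (phi _ (l2 _)); lra.
- move=> Xpath a; have [w wP] := Xpath (phi a x0); have [cw w0 w1] := wP.
  have fP : is_loop (q x0) (q \o w).
    split; [|by rewrite /= w0|by rewrite /= w1 ?q_phi].
    by apply: continuous_subspaceT; exact: continuous_compT cw q_continuous.
  exists (loop_class (Loop fP)); apply: (@piE _ w); last by rewrite w1.
  split=> //; first by rewrite w0.
  by move=> t /=; rewrite (joins_clamp _ wP).
- move=> g; have [l ->] := loop_class_surj g; rewrite pushE.
  apply: (@piE _ (fun t => l (clamp t))); last by rewrite clamp1 loop1 phi0.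
  by split=> //; [exact: loop_continuous|rewrite clamp0 loop0].
- move=> g g0; have [l [cl l0 ql]] := piP g; rewrite g0 phi0 => l1.
  have lP : is_loop x0 l by split=> //; exact: continuous_subspaceT.
  exists (Loop lP); rewrite -[g]reprK; apply/loop_classP.
  apply: (@reparam_homotopic _ _ _ (repr g) _ _ id id); rewrite //; try by continuity.
  - by move=> t t01; rewrite clampE.
  - by move=> t _; exact: ql.
Qed.

End Monodromy.

(** * Path-connectedness of the covering *)

Section PathComponents.
Variables (R : realType) (X : topologicalType).

Definition path_joined (x y : X) : Prop := exists w : R -> X, joins w x y.

Lemma path_joined_refl x : path_joined x x.
Proof. by exists (fun=> x); split=> //; exact: fun_continuous_cst. Qed.

Lemma path_joined_sym x y : path_joined x y -> path_joined y x.
Proof.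
move=> [w [cw w0 w1]]; exists (fun t => w (1 - t)); split=> [|t t0|t t1].
- by apply: (@continuous_compT _ _ _ (fun t : R => 1 - t) w _ cw); continuity.
- by rewrite w1 //; lra.
- by rewrite w0 //; lra.
Qed.

Lemma path_joined_trans x y z :
  path_joined x y -> path_joined y z -> path_joined x z.
Proof.
move=> [w [cw w0 w1]] [w' [cw' w'0 w'1]].
exists (fun t => if 2 * t - 1 <= 0 then w (2 * t) else w' (2 * t - 1)).
have c2 : continuous (fun t : R => 2 * t) by continuity.
split=> [|t t0|t t1].
- apply: (@glue_continuous _ _ _ (fun t : R => 2 * t - 1) (fun t => w (2 * t))
    (fun t => w' (2 * t - 1))).
  + by continuity.
  + exact: (continuous_compT c2 cw).
  + by apply: (@continuous_compT _ _ _ (fun t : R => 2 * t - 1) w' _ cw'); continuity.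
  + by move=> t t0; rewrite w1 ?w'0 //; lra.
- by rewrite ifT ?w0 //; lra.
- by rewrite ifF ?w'1 //; [lra|apply/negbTE; lra].
Qed.

Lemma path_joined_image (L : R -> X) : continuous L -> path_joined (L 0) (L 1).
Proof.
move=> cL; exists (fun t => L (clamp t)); split=> [|t t0|t t1].
- exact: (continuous_compT (@clamp_continuous R) cL).
- by rewrite clamp_le0.
- by rewrite clamp_ge1.
Qed.

End PathComponents.

Section DiskGeometry.
Variable R : realType.

Definition segment n (x y : 'rV[R]_n) (t : R) : 'rV[R]_n :=
  x + clamp t *: (y - x).

Lemma segment_continuous n (x y : 'rV[R]_n) : continuous (segment x y).
Proof.
apply: fun_continuous_row => j.
apply: (@fun_continuous_ext _ _ (fun t => x 0 j + clamp t * (y 0 j - x 0 j))).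
  by move=> t; rewrite !mxE.
by have := @clamp_continuous R => ?; continuity.
Qed.

Lemma segment_disk n (x y : 'rV[R]_n) t :
  @disk R n x -> @disk R n y -> @disk R n (segment x y t).
Proof.
rewrite /disk /= => x1 y1.
have := @clampI R t; rewrite /= in_itv /=; set s := clamp t => /andP[s0 s1].
apply: (@le_trans _ _ (\sum_i ((1 - s) * x 0 i ^+ 2 + s * y 0 i ^+ 2))).
  apply: ler_sum => i _; rewrite !mxE -/s.
  (* This is the convexity defect of the square function, the exact difference of the two sides. *)
  have : 0 <= s * (1 - s) * (x 0 i - y 0 i) ^+ 2.
    by rewrite mulr_ge0 ?sqr_ge0 // mulr_ge0 // subr_ge0.
  by move: (x 0 i) (y 0 i) => a b; nra.
rewrite big_split /= -!mulr_sumr; nra.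
Qed.

Lemma segment_ball n (x y : 'rV[R]_n) e t : ball x e y -> ball x e (segment x y t).
Proof.
move=> [e0 xy]; split=> // i j; have := xy i j; rewrite ord1 !mxE /ball /=.
have := @clampI R t; rewrite /= in_itv /=; set s := clamp t => /andP[s0 s1].
move: (x 0 j) (y 0 j) => a b.
rewrite opprD addrA subrr sub0r normrN normrM ger0_norm // distrC => ab.
by apply: le_lt_trans ab; rewrite ler_piMl.
Qed.

Lemma disk_closed n : closed (@disk R n).
Proof.
apply: (@preimage_closed _ _ (fun x : 'rV[R]_n => \sum_i x 0 i ^+ 2) [set x | x <= 1]);
  last exact: closed_le.
move=> x _; move: x.
apply: (@fun_continuous_sum _ _ _ _ (fun i (x : 'rV[R]_n) => x 0 i ^+ 2)) => i.
have c : continuous (fun x : 'rV[R]_n => x 0 i) by exact: coord_continuous.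
apply: (@fun_continuous_ext _ _ (fun x : 'rV[R]_n => x 0 i * x 0 i)) => //.
by continuity.
Qed.

End DiskGeometry.

Section CoveringOfCW.
Variables (R : realType) (X B : topologicalType) (q : X -> B).
Hypotheses (qcov : covering_map q) (cw : finite_CW_structure R B).

(* The image in [B] of the part of [P] in a sheet is open because its preimage
   in every disk is, disks being locally convex. *)
Lemma path_saturated_open (P : set X) :
  (forall x y, path_joined R x y -> P x -> P y) -> open P.
Proof.
move=> Psat; rewrite openE => x Px; rewrite /interior.
have [cq _ /(_ (q x))[U Ux [sheets [oU qU _ shP]]]] := qcov.
have : (q @^-1` U) x by [].
rewrite qU => -[V sV Vx]; have [oV Vbij Vop] := shP V sV.
have [VU Vinj Vsurj] := Vbij.
pose W := q @` (V `&` P).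
have oW : open W.
  rewrite -[W]setCK openC; apply: (closed_cellwise (f := cw)) => e.
  rewrite -[X in closed X]setCK closedC openE => d dW; rewrite /= /interior.
  have [dd|nd] := pselect (@disk R (cell_dim e) d); last first.
    have := @disk_closed R (cell_dim e); rewrite -openC openE => /(_ d nd).
    by apply: filterS => d' nd' [].
  have [v [Vv Pv] vd] : W (@char_map _ _ cw e d) by apply: contrapT => nW; apply: dW.
  have : nbhs (@char_map _ _ cw e d) U.
    by apply: open_nbhs_nbhs; split=> //; rewrite -vd; exact: VU.
  have /subspace_continuousP/(_ _ dd) ce := @char_map_continuous _ _ cw e.
  move=> /ce /nbhs_ballP[r /= r0 rU].
  apply/nbhs_ballP; exists r => //= d' dd'; rewrite /= => -[dd1]; apply.
  (* The image of the segment from [d] to [d'] lifts to a path in [V] starting at [v], so its end is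
     again in [P]. *)
  have [||L [cL LV qL]] := @lift_in_sheet _ _ q _
    (fun t => @char_map _ _ cw e (segment d d' t)) U V Vbij Vop oV.
  - apply: (within_comp (@segment_continuous _ _ d d') (@char_map_continuous _ _ cw e)) => t.
    exact: segment_disk.
  - move=> t; apply: rU; first exact: segment_ball.
    exact: segment_disk.
  exists (L 1); last by rewrite qL /segment clamp1 scale1r addrC subrK.
  split; first exact: LV.
  apply: (Psat (L 0)); first exact: path_joined_image.
  suff -> : L 0 = v by [].
  by apply: Vinj; rewrite ?inE // qL /segment clamp0 scale0r addr0 vd.
have : nbhs x (V `&` q @^-1` W).
  apply: filterI; first exact: open_nbhs_nbhs.
  by apply: cq; apply: open_nbhs_nbhs; split=> //; exists x.
apply: filterS => y [Vy [v [Vv Pv] vy]].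
by rewrite -(Vinj v y) ?inE.
Qed.

(** The path component of [x0] and its complement are both saturated, hence both open. *)
Lemma covering_path_connected x0 :
  connected [set: X] -> forall x, exists w : R -> X, joins w x0 x.
Proof.
move=> cX; suff E : path_joined R x0 = setT :> set X.
  by move=> x; have : setT x by []; rewrite -E.
apply: cX; first by exists x0; exact: path_joined_refl.
- exists (path_joined R x0); last by rewrite setTI.
  by apply: path_saturated_open => x y xy x0x; exact: path_joined_trans xy.
- exists (path_joined R x0); last by rewrite setTI.
  rewrite -openC; apply: path_saturated_open => x y xy nx0x x0y; apply: nx0x.
  exact/(path_joined_trans x0y)/path_joined_sym.
Qed.

End CoveringOfCW.

(** * The bound on the first Betti number of the covering *)

Theorem theorem1p6 (R : realType) (p : nat) (B : topologicalType) (b0 : B) :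
  prime p ->
  finite_CW_complex R B ->
  connected [set: B] ->
  homology_eq0 'F_p (nerve (fundamental_group R b0)) 2 ->
  forall (r : nat) (X : topologicalType) (q : X -> B),
    regular_covering q 'rV['F_p]_r ->
    ((2 ^ r - 1)%N%:R%:E <= betti R 'F_p X 1)%E.
Proof.
move=> p_pr [_ [cw]] _ H2 r X q qreg.
have [Xcon qcov _ _] := qreg; have [_ qsurj _] := qcov.
have : range q b0 by rewrite qsurj.
case=> x0 _ x0b; subst b0.
have Xpath := @covering_path_connected _ _ _ _ qcov cw x0 Xcon.
have [pi [piM pi_surj pi_push pi_ker]] := exists_monodromy R x0 qreg.
have [k [theta [x [thetaM x_ker free]]]] :=
  free_kernel_characters p_pr H2 piM (pi_surj Xpath).
have /choice[l lE] i := pi_ker _ (x_ker i).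
(* The image of [push] lies in the kernel of [pi], so composing with [push] makes the [theta j]
   additive on the whole fundamental group of [X]. *)
apply: (@betti1_lower_bound _ _ _ x0 k _ (fun j y => theta j (push qreg y)) l) => //.
  by move=> j y z; rewrite pushM thetaM.
suff -> : \matrix_(i, j) theta j (push qreg (loop_class (l i))) =
  \matrix_(i, j) theta j (x i) by [].
by apply/matrixP => i j; rewrite !mxE pushE -lE.
Qed.
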